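(* Let $n\ge 3$ and let $\mathcal{M}=T^{2n}$ be the $2n$-dimensional torus with the standard symplectic structure $\omega$. Then for every integer $k$ with $1<k<n$, the Euler-Lagrange cohomology group $H^{2k-1}_{\mathrm{EL}}(T^{2n},\omega)$ is not isomorphic, as a real vector space, to the de Rham cohomology group $H^{2k-1}_{\mathrm{dR}}(T^{2n})$.
   Context: For a $2n$-dimensional symplectic manifold $(\mathcal{M},\omega)$ let $\mathcal{X}(\mathcal{M})$ be the space of smooth vector fields, $i_X$ contraction with $X$, and $\omega^k$ the $k$-fold wedge product of $\omega$. For $1\le k\le n$ put $\mathcal{X}_{\mathrm{S}}^{2k-1}(\mathcal{M},\omega):=\{X\in\mathcal{X}(\mathcal{M}) : \mathcal{L}_X(\omega^k)=0\}$ and $\mathcal{X}_{\mathrm{H}}^{2k-1}(\mathcal{M},\omega):=\{X\in\mathcal{X}(\mathcal{M}) : -i_X(\omega^k)\text{ is exact}\}\subseteq \mathcal{X}_{\mathrm{S}}^{2k-1}(\mathcal{M},\omega)$. The $(2k-1)$st Euler-Lagrange cohomology group is $H^{2k-1}_{\mathrm{EL}}(\mathcal{M},\omega):=\mathcal{X}_{\mathrm{S}}^{2k-1}(\mathcal{M},\omega)/\mathcal{X}_{\mathrm{H}}^{2k-1}(\mathcal{M},\omega)$. The standard symplectic structure on $T^{2n}=\mathbb{R}^{2n}/\mathbb{Z}^{2n}$ is the one induced by $\sum_{i=1}^n \mathrm{d}p_i\wedge\mathrm{d}q^i$. *)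

(* Defs.v *)
From HB Require Import structures.
From mathcomp Require Import all_boot all_order all_algebra perm.
From mathcomp Require Import archimedean generic_quotient ring_quotient.
From mathcomp Require Import boolp classical_sets functions reals topology.
From mathcomp Require Import normedtype derive.

Set Implicit Arguments.
Unset Strict Implicit.
Unset Printing Implicit Defensive.

Import Order.TTheory GRing.Theory Num.Theory numFieldNormedType.Exports.

Local Open Scope classical_set_scope.
Local Open Scope ring_scope.
Local Open Scope quotient_scope.

Section Subquotient.
Variables (F : pzRingType) (V : lmodType F) (P Q : submodClosed V).

Record sub_lmod := SubLmod { sub_lmod_val : V ; _ : sub_lmod_val \in P }.

HB.instance Definition _ := [isSub for sub_lmod_val].
HB.instance Definition _ := [Choice of sub_lmod by <:].
HB.instance Definition _ := [SubChoice_isSubLmodule of sub_lmod by <:].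

Definition sub_trace : {pred sub_lmod} := [pred x | val x \in Q].

Fact sub_trace_submod_closed : submod_closed sub_trace.
Proof.
split; rewrite ?inE ?raddf0 ?rpred0 // => a x y; rewrite !inE => Qx Qy.
by rewrite linearP rpredD // rpredZ.
Qed.

HB.instance Definition _ :=
  GRing.isSubmodClosed.Build F sub_lmod sub_trace sub_trace_submod_closed.

(* The quotient vector space P / (P :&: Q); it is P / Q when Q is contained
   in P. *)
Definition subquot : Type := Quotient.quot sub_trace.

HB.instance Definition _ := GRing.Zmodule.on subquot.
HB.instance Definition _ := EqQuotient.on subquot.

Definition subquot_scale (a : F) (x : subquot) : subquot :=
  \pi_subquot (a *: repr x).

Fact subquot_scale_pi a (x : sub_lmod) :
  subquot_scale a (\pi_subquot x) = \pi_subquot (a *: x).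
Proof.
apply/eqP; rewrite -Quotient.idealrBE -scalerBr rpredZ //.
by rewrite Quotient.idealrBE reprK.
Qed.

Fact subquot_piD (x y : sub_lmod) :
  \pi_subquot (x + y) = \pi_subquot x + \pi_subquot y.
Proof. exact: (Quotient.pi_add sub_trace x y). Qed.

Fact subquot_scaleA a b x :
  subquot_scale a (subquot_scale b x) = subquot_scale (a * b) x.
Proof.
by elim/quotW: x => x; rewrite (subquot_scale_pi b) !subquot_scale_pi scalerA.
Qed.

Fact subquot_scale1 : left_id 1 subquot_scale.
Proof. by elim/quotW=> x; rewrite subquot_scale_pi scale1r. Qed.

Fact subquot_scaleDr : right_distributive subquot_scale +%R.
Proof.
move=> a; elim/quotW=> x; elim/quotW=> y.
by rewrite -subquot_piD !subquot_scale_pi scalerDr subquot_piD.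
Qed.

Fact subquot_scaleDl x : {morph subquot_scale^~ x : a b / a + b}.
Proof.
by elim/quotW: x => x a b; rewrite !subquot_scale_pi scalerDl subquot_piD.
Qed.

HB.instance Definition _ := GRing.Zmodule_isLmodule.Build F subquot
  subquot_scaleA subquot_scale1 subquot_scaleDr subquot_scaleDl.

End Subquotient.

Section Smooth.
Variables (R : realType) (V W : normedModType R).
Implicit Types f g : V -> W.

Definition iter_derive (vs : seq V) f : V -> W :=
  foldr (fun v g => 'D_v g) f vs.

(* C^infinity: all iterated directional derivatives exist and are
   differentiable, hence continuous. *)
Definition smooth f :=
  forall (vs : seq V) (x : V), differentiable (iter_derive vs f) x.

Lemma smooth_derivable f x v : smooth f -> derivable f x v.
Proof. by move=> /(_ [::] x); exact: diff_derivable. Qed.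

Lemma smoothP a f g : smooth f -> smooth g -> smooth (a *: f + g).
Proof.
move=> sf sg.
suff E vs : iter_derive vs (a *: f + g) =
    a *: iter_derive vs f + iter_derive vs g.
  by move=> vs x; rewrite E; apply: differentiableD => //; exact: differentiableZ.
elim: vs => [//|v vs IH] /=; rewrite IH; apply/funext => x.
have df : derivable (iter_derive vs f) x v by exact: diff_derivable.
have dg : derivable (iter_derive vs g) x v by exact: diff_derivable.
by rewrite deriveD ?deriveZ //; exact: derivableZ.
Qed.

Lemma smooth_cst (c : W) : smooth (cst c).
Proof.
suff H (vs : seq V) : exists c', iter_derive vs (cst c) = cst c'.
  by move=> vs x; have [c' ->] := H vs; exact: differentiable_cst.
elim: vs => [|v vs [c' IH]] /=; first by exists c.
by exists 0; rewrite IH; apply/funext => x; exact: derive_cst.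
Qed.

End Smooth.

Section Torus.
Variables (R : realType) (m : nat).

Definition int_lattice : {pred 'rV[R]_m} :=
  [pred x : 'rV[R]_m | [forall j, x 0 j \is a Num.int]].

Fact int_lattice_zmod_closed : zmod_closed int_lattice.
Proof.
split=> [|x y]; rewrite !inE; first by apply/forallP => j; rewrite mxE rpred0.
move=> /forallP Zx /forallP Zy; apply/forallP => j.
by rewrite !mxE rpredB.
Qed.

HB.instance Definition _ :=
  GRing.isZmodClosed.Build 'rV[R]_m int_lattice int_lattice_zmod_closed.

Definition torus : Type := Quotient.quot int_lattice.

HB.instance Definition _ := GRing.Zmodule.on torus.
HB.instance Definition _ := EqQuotient.on torus.

Section Functions.
Variable W : normedModType R.
Implicit Type f : torus -> W.

(* The projection R^m -> torus is a smooth covering, so f is smooth iff its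
   lift to R^m is. *)
Definition tsmooth f := smooth (f \o \pi_torus).

(* The translation-invariant vector field v, applied to f; the choice of the
   representative of t is irrelevant, see tderive_pi. *)
Definition tderive (v : 'rV[R]_m) f (t : torus) : W :=
  'D_v (f \o \pi_torus) (repr t).

Lemma tderive_pi v f x : tderive v f (\pi_torus x) = 'D_v (f \o \pi_torus) x.
Proof.
rewrite /tderive /derive; set y := repr _.
have yx z : \pi_torus (z + y) = \pi_torus (z + x).
  by rewrite [LHS](Quotient.pi_add int_lattice) [RHS](Quotient.pi_add int_lattice) reprK.
set g := f \o \pi_torus.
suff -> : (fun h => h^-1 *: ((g \o shift y) (h *: v) - g y)) =
    (fun h : R => h^-1 *: ((g \o shift x) (h *: v) - g x)) by [].
by apply/funext => h; rewrite /g /= yx reprK.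
Qed.

Lemma tsmoothP a f g : tsmooth f -> tsmooth g -> tsmooth (a *: f + g).
Proof. exact: smoothP. Qed.

Lemma tsmooth_cst (c : W) : tsmooth (cst c).
Proof. exact: smooth_cst. Qed.

Lemma tderiveP v a f g t : tsmooth f -> tsmooth g ->
  tderive v (a *: f + g) t = a *: tderive v f t + tderive v g t.
Proof.
move=> sf sg; rewrite /tderive.
have df : derivable (f \o \pi_torus) (repr t) v by exact: smooth_derivable.
have dg : derivable (g \o \pi_torus) (repr t) v by exact: smooth_derivable.
rewrite -deriveZ // -deriveD //; exact: derivableZ.
Qed.

Lemma tderive_cst v (c : W) t : tderive v (cst c) t = 0.
Proof. exact: derive_cst. Qed.

End Functions.

(* The tangent bundle of the torus is trivialized by the coordinates of R^m. *)
Definition vfield : Type := torus -> 'rV[R]_m.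
HB.instance Definition _ := GRing.Lmodule.on vfield.

Definition lie_bracket (X Y : vfield) : vfield :=
  fun t => tderive (X t) Y t - tderive (Y t) X t.

(* eta t v is the value at t of eta on the tangent vectors row 0 v, ...,
   row (p - 1) v; multilinearity, alternation and smoothness are imposed by
   smooth_form. *)
Definition form (p : nat) : Type := torus -> 'M[R]_(p, m) -> R.
HB.instance Definition _ p := GRing.Lmodule.on (form p).

Definition set_row p (v : 'M[R]_(p, m)) (i : 'I_p) (u : 'rV[R]_m) :=
  \matrix_(k < p, j < m) (if k == i then u 0 j else v k j).

Definition multilinear p (f : 'M[R]_(p, m) -> R) :=
  forall (v : 'M[R]_(p, m)) (i : 'I_p) (a : R) (u w : 'rV[R]_m),
    f (set_row v i (a *: u + w)) = a * f (set_row v i u) + f (set_row v i w).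

Definition alternating p (f : 'M[R]_(p, m) -> R) :=
  forall (v : 'M[R]_(p, m)) (i j : 'I_p),
    i != j -> row i v = row j v -> f v = 0.

Definition smooth_form p (eta : form p) :=
  [/\ forall t, multilinear (eta t),
      forall t, alternating (eta t) &
      forall v, tsmooth (fun t => eta t v)].

(* The invariant formula for d on the commuting constant fields row i v. *)
Definition ext_d p (eta : form p) : form p.+1 :=
  fun t v => \sum_(i < p.+1)
    (-1) ^+ i * tderive (row i v) (fun s => eta s (row' i v)) t.

(* Normalized so that (dx_1 /\ ... /\ dx_p)(e_1, ..., e_p) = 1. *)
Definition wedge p q (eta : form p) (zeta : form q) : form (p + q) :=
  fun t v => (p`!%:R * q`!%:R)^-1 *
    \sum_(s : 'S_(p + q)) (-1) ^+ s *
      (eta t (usubmx (row_perm s v)) * zeta t (dsubmx (row_perm s v))).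

Fixpoint wedge_pow (eta : form 2) (k : nat) : form (k * 2) :=
  match k return form (k * 2) with
  | 0 => fun _ _ => 1
  | k'.+1 => wedge eta (@wedge_pow eta k')
  end.
Arguments wedge_pow : clear implicits.

Definition contract (X : vfield) p : form p -> form p.-1 :=
  match p return form p -> form p.-1 with
  | 0 => fun _ => 0
  | q.+1 => fun eta t (v : 'M[R]_(q, m)) => eta t (col_mx (X t) v)
  end.

(* (L_X eta)(Y_1, ..., Y_p) =
     X (eta(Y_1, ..., Y_p)) - \sum_i eta(Y_1, ..., [X, Y_i], ..., Y_p),
   with Y_i the constant field row i v. *)
Definition lie_derive (X : vfield) p (eta : form p) : form p :=
  fun t v => tderive (X t) (fun s => eta s v) t -
    \sum_(i < p) eta t (set_row v i (lie_bracket X (fun=> row i v) t)).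

Definition closed_form p (eta : form p) := smooth_form eta /\ ext_d eta = 0.

Definition exact_form p : form p -> Prop :=
  match p return form p -> Prop with
  | 0 => fun eta => eta = 0
  | q.+1 => fun eta => exists2 beta : form q, smooth_form beta & ext_d beta = eta
  end.

Lemma smooth_formP p a (eta zeta : form p) :
  smooth_form eta -> smooth_form zeta -> smooth_form (a *: eta + zeta).
Proof.
move=> [me ae se] [mz az sz]; split.
- move=> t v i b u w; rewrite !fctE /= !me !mz.
  rewrite /GRing.scale /= !mulrDr !mulrA [b * a]mulrC -!addrA; congr (_ + _).
  by rewrite addrCA.
- by move=> t v i j ij e; rewrite !fctE /= (ae _ _ _ _ ij e) (az _ _ _ _ ij e)
    scaler0 addr0.
- move=> v.
  rewrite (_ : (fun t => _) = a *: (eta ^~ v) + (zeta ^~ v)) //.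
  exact: tsmoothP.
Qed.

Lemma smooth_form0 p : smooth_form (0 : form p).
Proof.
split=> [t v i a u w|//|v]; first by rewrite mulr0 addr0.
exact: tsmooth_cst.
Qed.

Lemma ext_dP p a (eta zeta : form p) : smooth_form eta -> smooth_form zeta ->
  ext_d (a *: eta + zeta) = a *: ext_d eta + ext_d zeta.
Proof.
move=> [_ _ se] [_ _ sz]; apply/funext => t; apply/funext => v.
rewrite !fctE /ext_d scaler_sumr -big_split; apply: eq_bigr => i _ /=.
rewrite (tderiveP _ _ _ (se (row' i v)) (sz (row' i v))) mulrDr.
by rewrite scalerAr.
Qed.

Lemma ext_d0 p : ext_d (0 : form p) = 0.
Proof.
apply/funext => t; apply/funext => v; rewrite /ext_d big1 // => i _.
by rewrite (@tderive_cst R) mulr0.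
Qed.

Definition closed_forms p : {pred form p} := [pred eta | `[< closed_form eta >]].

Fact closed_forms_submod_closed p : submod_closed (@closed_forms p).
Proof.
split; first by apply/asboolP; split; [exact: smooth_form0|exact: ext_d0].
move=> a eta zeta /asboolP[se de] /asboolP[sz dz]; apply/asboolP; split.
  exact: smooth_formP.
by rewrite ext_dP // de dz scaler0 addr0.
Qed.

HB.instance Definition _ p :=
  GRing.isSubmodClosed.Build R (form p) (@closed_forms p)
    (@closed_forms_submod_closed p).

Lemma exact_formP p a (eta zeta : form p) :
  exact_form eta -> exact_form zeta -> exact_form (a *: eta + zeta).
Proof.
case: p eta zeta => [|p] eta zeta /=; first by move=> -> ->; rewrite scaler0 addr0.
move=> [b sb <-] [c sc <-]; exists (a *: b + c); first exact: smooth_formP.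
by rewrite ext_dP.
Qed.

Lemma exact_form0 p : exact_form (0 : form p).
Proof. by case: p => [//|p]; exists 0; [exact: smooth_form0|exact: ext_d0]. Qed.

Definition exact_forms p : {pred form p} := [pred eta | `[< exact_form eta >]].

Fact exact_forms_submod_closed p : submod_closed (@exact_forms p).
Proof.
split; first by apply/asboolP; exact: exact_form0.
by move=> a eta zeta /asboolP? /asboolP?; apply/asboolP; exact: exact_formP.
Qed.

HB.instance Definition _ p :=
  GRing.isSubmodClosed.Build R (form p) (@exact_forms p)
    (@exact_forms_submod_closed p).

Definition deRham (p : nat) : lmodType R :=
  subquot (@closed_forms p) (@exact_forms p).

Lemma set_row_col_mx p (x u : 'rV[R]_m) (v : 'M[R]_(p, m)) :
  set_row (col_mx x v : 'M_(p.+1, m)) ord0 u = col_mx u v.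
Proof.
apply/matrixP => k j; rewrite mxE.
case: (@split_ordP 1 p k) => l ->; last by rewrite !(@col_mxEd _ 1 p).
by rewrite !(@col_mxEu _ 1 p) ord1.
Qed.

Lemma contractP p (eta : form p) a (X Y : vfield) :
  (forall t, multilinear (eta t)) ->
  contract (a *: X + Y) eta = a *: contract X eta + contract Y eta.
Proof.
case: p eta => [|p] eta me; first by rewrite scaler0 addr0.
apply/funext => t; apply/funext => v; rewrite !fctE /contract.
rewrite -[eta t _](congr1 (eta t) (set_row_col_mx 0 (a *: X t + Y t) v)).
by rewrite me !set_row_col_mx.
Qed.

Lemma set_row_usub p q (s : 'S_(p + q)) (v : 'M[R]_(p + q, m)) i u (j : 'I_p) :
  s (lshift q j) = i ->
  usubmx (row_perm s (set_row v i u)) = set_row (usubmx (row_perm s v)) j u /\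
  dsubmx (row_perm s (set_row v i u)) = dsubmx (row_perm s v).
Proof.
move=> <-; split; apply/matrixP => k l; rewrite !mxE (inj_eq perm_inj).
  by rewrite (inj_eq (@lshift_inj _ _)).
by rewrite eq_rlshift.
Qed.

Lemma set_row_dsub p q (s : 'S_(p + q)) (v : 'M[R]_(p + q, m)) i u (j : 'I_q) :
  s (rshift p j) = i ->
  dsubmx (row_perm s (set_row v i u)) = set_row (dsubmx (row_perm s v)) j u /\
  usubmx (row_perm s (set_row v i u)) = usubmx (row_perm s v).
Proof.
move=> <-; split; apply/matrixP => k l; rewrite !mxE (inj_eq perm_inj).
  by rewrite (inj_eq (@rshift_inj _ _)).
by rewrite eq_lrshift.
Qed.

Lemma wedge_multilinear p q (eta : form p) (zeta : form q) t :
  multilinear (eta t) -> multilinear (zeta t) -> multilinear (wedge eta zeta t).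
Proof.
move=> me mz v i a u w; rewrite /wedge [a * _]mulrCA -[RHS]mulrDr; congr (_ * _).
rewrite mulr_sumr -big_split; apply: eq_bigr => s _ /=.
rewrite [a * _]mulrCA -[RHS]mulrDr; congr (_ * _).
have := permKV s i; case: (split_ordP (s^-1%g i)) => j -> sj.
  have [-> ->] := set_row_usub v (a *: u + w) sj.
  have [-> ->] := set_row_usub v u sj; have [-> ->] := set_row_usub v w sj.
  by rewrite me mulrDl mulrA.
have [-> ->] := set_row_dsub v (a *: u + w) sj.
have [-> ->] := set_row_dsub v u sj; have [-> ->] := set_row_dsub v w sj.
by rewrite mz mulrDr mulrCA.
Qed.

Lemma wedge_pow_multilinear (eta : form 2) k t :
  multilinear (eta t) -> multilinear (wedge_pow eta k t).
Proof.
by move=> me; elim: k => [_ []//|k IH] /=; exact: wedge_multilinear.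
Qed.

Lemma wedge_pow_const (eta : form 2) k t s :
  eta t = eta s -> wedge_pow eta k t = wedge_pow eta k s.
Proof.
move=> e; elim: k => [//|k IH] /=; apply/funext => v.
by rewrite /wedge e IH.
Qed.

Lemma lie_derive_const (X : vfield) p (eta : form p) :
  (forall t s, eta t = eta s) -> (forall t, multilinear (eta t)) ->
  lie_derive X eta =
  fun t v => \sum_(i < p) eta t (set_row v i (tderive (row i v) X t)).
Proof.
move=> ce me; apply/funext => t; apply/funext => v; rewrite /lie_derive.
rewrite (_ : (fun s => eta s v) = cst (eta t v)); last first.
  by apply/funext => s; rewrite (ce s t).
rewrite tderive_cst sub0r -sumrN; apply: eq_bigr => i _.
rewrite /lie_bracket [tderive (X t) _ t]tderive_cst sub0r.
set y := tderive _ _ _.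
have m0 : eta t (set_row v i 0) = 0.
  have := me t v i (-1) 0 0; rewrite scaler0 addr0 mulN1r => ->.
  by rewrite addNr.
by have := me t v i (-1) y 0; rewrite m0 addr0 scaleN1r addr0 mulN1r => ->; rewrite opprK.
Qed.

End Torus.

Arguments wedge_pow {R m} eta k.

Section EulerLagrange.
Variables (R : realType) (n : nat).
Notation vfield := (vfield R (n + n)).
Notation form := (form R (n + n)).

Definition dcoord (j : 'I_(n + n)) : form 1 := fun _ v => v 0 j.

(* The coordinates of R^(n + n) are (p_1, ..., p_n, q^1, ..., q^n). *)
Definition std_symp : form 2 :=
  \sum_(i < n) wedge (dcoord (lshift n i)) (dcoord (rshift n i)).

Definition symp_field (k : nat) (X : vfield) :=
  tsmooth X /\ lie_derive X (wedge_pow std_symp k) = 0.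

Definition ham_field (k : nat) (X : vfield) :=
  tsmooth X /\ exact_form (- contract X (wedge_pow std_symp k)).

Lemma std_symp_const t s : std_symp t = std_symp s.
Proof. by rewrite /std_symp !fct_sumE. Qed.

Lemma std_symp_multilinear t : multilinear (std_symp t).
Proof.
rewrite /std_symp fct_sumE => v i a u w; rewrite !fct_sumE.
rewrite mulr_sumr -big_split; apply: eq_bigr => j _ /=.
by apply: wedge_multilinear => {}v {}i {}a {}u {}w; rewrite /dcoord !mxE !ord1 eqxx.
Qed.

Lemma std_symp_pow_const k t s :
  wedge_pow std_symp k t = wedge_pow std_symp k s.
Proof. exact: wedge_pow_const (std_symp_const t s). Qed.

Lemma std_symp_pow_multilinear k t : multilinear (wedge_pow std_symp k t).
Proof. exact/wedge_pow_multilinear/std_symp_multilinear. Qed.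

Definition symp_fields (k : nat) : {pred vfield} :=
  [pred X | `[< symp_field k X >]].

Definition ham_fields (k : nat) : {pred vfield} :=
  [pred X | `[< ham_field k X >]].

Fact symp_fields_submod_closed k : submod_closed (symp_fields k).
Proof.
split.
  apply/asboolP; split; first exact: tsmooth_cst.
  rewrite (lie_derive_const _ (@std_symp_pow_const k) (@std_symp_pow_multilinear k)).
  apply/funext => t; apply/funext => v; rewrite big1 // => i _.
  have := (@std_symp_pow_multilinear k) t v i (-1) 0 0; rewrite scaler0 addr0 mulN1r addNr.
  by rewrite [tderive _ _ _]tderive_cst.
move=> a X Y /asboolP[sX lX] /asboolP[sY lY]; apply/asboolP; split.
  exact: tsmoothP.
move: lX lY; rewrite !(lie_derive_const _ (@std_symp_pow_const k) (@std_symp_pow_multilinear k)) => lX lY.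
apply/funext => t; apply/funext => v.
have {}lX := congr1 (fun f : form _ => f t v) lX.
have {}lY := congr1 (fun f : form _ => f t v) lY.
under eq_bigr do rewrite tderiveP // std_symp_pow_multilinear.
by rewrite big_split -mulr_sumr /= lX lY mulr0 addr0.
Qed.

HB.instance Definition _ k := GRing.isSubmodClosed.Build R vfield
  (symp_fields k) (symp_fields_submod_closed k).

Fact ham_fields_submod_closed k : submod_closed (ham_fields k).
Proof.
split.
  apply/asboolP; split; first exact: tsmooth_cst.
  have := contractP (-1) 0 0 (@std_symp_pow_multilinear k).
  rewrite scaler0 addr0 scaleN1r addNr => ->; rewrite oppr0; exact: exact_form0.
move=> a X Y /asboolP[sX lX] /asboolP[sY lY]; apply/asboolP; split.
  exact: tsmoothP.
rewrite contractP; last exact: std_symp_pow_multilinear.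
rewrite opprD -scalerN; exact: exact_formP.
Qed.

HB.instance Definition _ k := GRing.isSubmodClosed.Build R vfield
  (ham_fields k) (ham_fields_submod_closed k).

(* The Euler-Lagrange cohomology group of degree 2k - 1. *)
Definition EulerLagrange (k : nat) : lmodType R :=
  subquot (symp_fields k) (ham_fields k).

End EulerLagrange.

(* Main.v *)
(* Pointwise, i_X(omega^k) = k (i_X omega) /\ omega^(k-1) and
   L_X(omega^k) = k (L_X omega) /\ omega^(k-1). For k < n the second identity,
   evaluated on symplectic frames, shows that L_X(omega^k) = 0 forces i_X omega
   to be a closed 1-form. If its 2n periods vanish then i_X omega = dh, and
   i_X(omega^k) = d(k h omega^(k-1)) is exact; hence the Euler-Lagrange group
   has dimension at most 2n. On the other hand the constant forms
   dx_(i_1) /\ ... /\ dx_(i_p) are independent modulo exact forms, because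
   derivatives of periodic functions have mean zero, so H_dR^(2k-1) has
   dimension at least 'C(2n, 2k-1) > 2n. *)
From HB Require Import structures.
From mathcomp Require Import all_boot all_order all_algebra fingroup perm.
From mathcomp Require Import archimedean generic_quotient ring_quotient.
From mathcomp Require Import boolp classical_sets functions reals.
From mathcomp Require Import interval_inference topology normedtype landau derive.
From mathcomp Require Import measure lebesgue_measure lebesgue_integral ftc.
From mathcomp Require Import ring lra zify.
Require Import Defs.

Set Implicit Arguments.
Unset Strict Implicit.
Unset Printing Implicit Defensive.

Import Order.TTheory GRing.Theory Num.Theory numFieldNormedType.Exports.

(** * Pfaffian sums *)

Section PfaffianSums.
Local Open Scope ring_scope.

(** [wedge] is a normalised sum over permutations, so iterating it gives nested sums. They collapse
    to a single permutation sum, a multiple of the Pfaffian of the pairings of the rows, and its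
    expansion along the first row makes powers of omega computable. Closedness of i_X omega is
    linear algebra at one point, with L the derivative of X. A frame for omega^k occupies k
    coordinate planes; comparing frames that differ in one pair needs two planes outside the k - 1
    others, which is what k < n provides. For k = n the condition only says that X is
    divergence-free. No integral over the torus occurs: mean zero becomes smallness of finite
    averages of translates, and one-variable integrals serve only to build primitives. Neither
    dimension is computed: more than 2n classes are dependent on one side, 'C(2n, 2k-1) explicit
    ones are independent on the other. For k = 1 the two counts coincide, hence 1 < k. *)

Lemma lift_perm_inj n (i j : 'I_n.+1) : injective (lift_perm i j).
Proof.
move=> s t st; apply/permP => k; apply: (@lift_inj _ j).
by rewrite -!(lift_perm_lift i) st.
Qed.

Lemma lift_perm_onto n (i j : 'I_n.+1) (s : 'S_n.+1) :
  s i = j -> exists t, s = lift_perm i j t.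
Proof.
move=> sij.
have uk k : {k' | s (lift i k) = lift j k'}.
  case: (unliftP j (s (lift i k))) => [k' ->|]; first by exists k'.
  by rewrite -sij => /perm_inj/eqP; rewrite eq_sym (negPf (neq_lift _ _)).
have uinj : injective (fun k => sval (uk k)).
  move=> k l kl; apply/(@lift_inj _ i)/(@perm_inj _ s).
  by rewrite (svalP (uk k)) (svalP (uk l)) kl.
exists (perm uinj); apply/permP => k.
case: (unliftP i k) => [k'|] ->; last by rewrite lift_perm_id.
by rewrite lift_perm_lift permE -(svalP (uk k')).
Qed.

Lemma sum_lift_perm (A : nmodType) n (i j : 'I_n.+1) (F : 'S_n.+1 -> A) :
  \sum_(s : 'S_n.+1 | s i == j) F s = \sum_(s : 'S_n) F (lift_perm i j s).
Proof.
pose h s := [pick t | s == lift_perm i j t].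
rewrite (reindex_omap (lift_perm i j) h) => [|s /eqP sij].
  apply: eq_bigl => s; rewrite lift_perm_id eqxx /h /=.
  by case: pickP => [t /eqP/lift_perm_inj -> /=|/(_ s)]; rewrite eqxx.
rewrite /h; case: pickP => [t /eqP -> //|].
by have [t -> /(_ t)/eqP] := lift_perm_onto sij.
Qed.

Variable R : comPzRingType.

(** The two slots of the i-th factor. [k.+1 * 2] reduces to [(k * 2).+2], so deleting the first
    block is [lift ord0] applied twice. *)
Definition lo k (i : 'I_k) : 'I_(k * 2) :=
  @Ordinal (k * 2) (i * 2)%N ltac:(by rewrite ltn_pmul2r).
Definition hi k (i : 'I_k) : 'I_(k * 2) :=
  @Ordinal (k * 2) (i * 2).+1 ltac:(by have := ltn_ord i; lia).

Lemma lohiP k (c : 'I_(k * 2)) : exists i, c = lo i \/ c = hi i.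
Proof.
have lt_ck : (c %/ 2 < k)%N by rewrite ltn_divLR.
exists (Ordinal lt_ck); have := modn2 c; have := divn_eq c 2.
by case: (odd c) => /= e; [right|left]; apply: val_inj; rewrite /=; lia.
Qed.

Lemma lo_inj k : injective (@lo k).
Proof. by move=> i j /(congr1 val) /= e; apply: val_inj; rewrite /=; lia. Qed.

Lemma hi_inj k : injective (@hi k).
Proof. by move=> i j /(congr1 val) /= e; apply: val_inj; rewrite /=; lia. Qed.

Lemma lo_hi k (i j : 'I_k) : (lo i == hi j) = false.
Proof. by apply/eqP => /(congr1 val) /= e; lia. Qed.

Lemma lo_ord0 k : lo ord0 = ord0 :> 'I_(k.+1 * 2).
Proof. exact: val_inj. Qed.

Lemma hi_ord0 k : hi ord0 = lift ord0 ord0 :> 'I_(k.+1 * 2).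
Proof. exact: val_inj. Qed.

Lemma lo_lift k (i : 'I_k) :
  lo (lift ord0 i) = lift ord0 (lift ord0 (lo i)) :> 'I_(k.+1 * 2).
Proof. exact: val_inj. Qed.

Lemma hi_lift k (i : 'I_k) :
  hi (lift ord0 i) = lift ord0 (lift ord0 (hi i)) :> 'I_(k.+1 * 2).
Proof. exact: val_inj. Qed.

Definition pfterm k (b : 'I_(k * 2) -> 'I_(k * 2) -> R) (s : 'S_(k * 2)) : R :=
  (-1) ^+ s * \prod_(i < k) b (s (lo i)) (s (hi i)).

(** For alternating b this is 2^k k! times the Pfaffian; keeping the multiplicity avoids division in
    R. *)
Definition pfsum k (b : 'I_(k * 2) -> 'I_(k * 2) -> R) : R :=
  \sum_(s : 'S_(k * 2)) pfterm b s.

Definition swap_blocks k (i j : 'I_k) : 'S_(k * 2) :=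
  (tperm (lo i) (lo j) * tperm (hi i) (hi j))%g.

Lemma swap_blocks_lo k (i j l : 'I_k) :
  swap_blocks i j (lo l) = lo (tperm i j l).
Proof.
rewrite permM -(inj_tperm i j l (@lo_inj k)).
by rewrite (@tpermD _ (hi i)) // eq_sym lo_hi.
Qed.

Lemma swap_blocks_hi k (i j l : 'I_k) :
  swap_blocks i j (hi l) = hi (tperm i j l).
Proof.
rewrite permM (@tpermD _ (lo i)) ?lo_hi //.
by rewrite (inj_tperm i j l (@hi_inj k)).
Qed.

(** Two transpositions make an even permutation, and it only reorders commuting factors. *)
Lemma pfterm_swap_blocks k b (i j : 'I_k) (s : 'S_(k * 2)) :
  pfterm b (swap_blocks i j * s)%g = pfterm b s.
Proof.
rewrite /pfterm !odd_permM !odd_tperm (inj_eq (@lo_inj k)) (inj_eq (@hi_inj k)).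
rewrite addbb /=; congr (_ * _).
rewrite [RHS](reindex_inj (@perm_inj _ (tperm i j))) /=.
by apply: eq_bigr => l _; rewrite !(permM _ s) swap_blocks_lo swap_blocks_hi.
Qed.

(** The sign of the transposition cancels the sign from skewness of b. *)
Lemma pfterm_swap_pair k b (i : 'I_k) (s : 'S_(k * 2)) :
  (forall i j, b i j = - b j i) ->
  pfterm b (tperm (lo i) (hi i) * s)%g = pfterm b s.
Proof.
move=> bN; rewrite /pfterm odd_permM odd_tperm lo_hi /=.
rewrite signrN [in LHS](bigD1 i) // [in RHS](bigD1 i) //= !(permM _ s) tpermL tpermR.
rewrite (bN (s (hi i))) !mulNr mulrN opprK; congr (_ * (_ * _)).
by apply: eq_bigr => l li; rewrite !permM !tpermD // ?lo_hi //
  ?(inj_eq (@lo_inj k)) ?(inj_eq (@hi_inj k)) eq_sym // ?lo_hi.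
Qed.

(* Moving the block containing the preimage of 0 to the front, with 0 in first
   position, does not change the term. *)
Lemma pfsum_perm0 k (b : 'I_(k.+1 * 2) -> 'I_(k.+1 * 2) -> R) :
  (forall i j, b i j = - b j i) ->
  pfsum b = (\sum_(s : 'S_(k.+1 * 2) | s ord0 == ord0) pfterm b s) *+ (k.+1 * 2).
Proof.
move=> bN; rewrite /pfsum.
rewrite (partition_big (fun s : 'S_(k.+1 * 2) => s^-1%g ord0) predT) //=.
rewrite -[X in _ *+ X]card_ord -sumr_const; apply: eq_bigr => c _.
have [i ci] := lohiP c.
have [r r0 rb] : {r : 'S_(k.+1 * 2) |
    r ord0 = c & forall s, pfterm b (r * s)%g = pfterm b s}.
  case: (eqVneq c (lo i)) => [-> | cN]; last first.
    have {}ci : c = hi i by case: ci => // e; rewrite e eqxx in cN.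
    exists (tperm (lo ord0) (hi ord0) * swap_blocks ord0 i)%g.
      by rewrite permM -lo_ord0 tpermL swap_blocks_hi tpermL ci.
    by move=> s; rewrite -mulgA pfterm_swap_pair // pfterm_swap_blocks.
  exists (swap_blocks ord0 i); first by rewrite -lo_ord0 swap_blocks_lo tpermL.
  exact: pfterm_swap_blocks.
rewrite (reindex_inj (mulgI r^-1)%g) /=; apply: eq_big => s; last first.
  by move=> _; rewrite -(rb (r^-1 * s)%g) mulKVg.
by rewrite invMg invgK permM -r0 (inj_eq perm_inj) -(inj_eq (@perm_inj _ s)) permKV
  eq_sym.
Qed.

(** Expansion of the Pfaffian along its first row: a permutation fixing 0 is split by its value on
    the partner of 0. The multiplicity is the ratio of 2^(k+1) (k+1)! to 2^k k!. *)
Lemma pfsum_expand k (b : 'I_(k.+1 * 2) -> 'I_(k.+1 * 2) -> R) :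
  (forall i j, b i j = - b j i) ->
  pfsum b = (\sum_(j < (k * 2).+1) (-1) ^+ j * b ord0 (lift ord0 j) *
    @pfsum k (fun i i' => b (lift ord0 (lift j i)) (lift ord0 (lift j i'))))
    *+ (k.+1 * 2).
Proof.
move=> bN; rewrite pfsum_perm0 //; congr (_ *+ _).
rewrite (sum_lift_perm (n := (k * 2).+1)).
rewrite (partition_big (fun s : 'S_(k * 2).+1 => s ord0) predT) //=.
apply: eq_bigr => j _; rewrite sum_lift_perm /pfsum mulr_sumr.
apply: eq_bigr => s _; rewrite /pfterm !odd_lift_perm /=.
rewrite signr_addb signr_odd -!mulrA; congr (_ * _).
rewrite mulrCA; congr (_ * _); rewrite big_ord_recl /=.
rewrite lo_ord0 hi_ord0 [in X in X * _]lift_perm_id lift_perm_lift lift_perm_id.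
congr (_ * _); apply: eq_bigr => i _.
by rewrite lo_lift hi_lift !lift_perm_lift.
Qed.

Lemma eq_pfsum k (b b' : 'I_(k * 2) -> 'I_(k * 2) -> R) :
  b =2 b' -> pfsum b = pfsum b'.
Proof.
move=> e; apply: eq_bigr => s _; congr (_ * _).
by apply: eq_bigr => i _; rewrite e.
Qed.

(** In every term c occurs in exactly one factor, with a partner different from c. *)
Lemma pfsum_isolated k (b : 'I_(k * 2) -> 'I_(k * 2) -> R) (c : 'I_(k * 2)) :
  (forall i j, b i j = - b j i) -> (forall i, i != c -> b c i = 0) -> pfsum b = 0.
Proof.
move=> bN b0; apply: big1 => s _.
have [i ci] := lohiP (s^-1%g c).
rewrite /pfterm (bigD1 i) //= (_ : b _ _ = 0) ?mul0r ?mulr0 //.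
have lh : s (lo i) != s (hi i) by rewrite (inj_eq perm_inj) lo_hi.
case: ci => /(canRL (permKV s)) ci; rewrite ci in b0.
  by rewrite b0 // eq_sym.
by rewrite bN b0 ?oppr0.
Qed.

Lemma pfsum_perm k b (r : 'S_(k * 2)) :
  pfsum (fun i j => b (r i) (r j)) = (-1) ^+ r * pfsum b :> R.
Proof.
rewrite /pfsum [in RHS](reindex_inj (mulIg r)) mulr_sumr.
apply: eq_bigr => s _; rewrite /pfterm odd_permM addbC signr_addb !mulrA.
rewrite -signr_addb addbb mul1r; congr (_ * _).
by apply: eq_bigr => i _; rewrite !permM.
Qed.

End PfaffianSums.

(** * Powers of a 2-form, evaluated on symplectic frames *)

Section SymplecticPowers.
Local Open Scope ring_scope.
Variables (R : realType) (m : nat).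
Variable B : 'rV[R]_m -> 'rV[R]_m -> R.
Variable eta : form R m 2.
Hypothesis etaE : forall t (v : 'M_(2, m)),
  eta t v = B (row ord0 v) (row ord_max v).

(** By induction there is an outer permutation s and an inner r. Extended by the identity on the
    first two slots, r is absorbed into s by translation, so all (2k)! choices of r contribute
    equally and cancel the factorial in [wedge]. *)
Lemma wedge_powE k t (v : 'M[R]_(k * 2, m)) :
  wedge_pow eta k t v = 2^-1 ^+ k * pfsum (fun i j => B (row i v) (row j v)).
Proof.
elim: k v => [|k IH] v.
  rewrite /= expr0 mul1r /pfsum (bigD1 1%g) //= big1 => [|s /eqP[]].
    by rewrite /pfterm big_ord0 odd_perm1 mulr1 addr0.
  by apply/permP => -[].
set b := fun i j => B (row i v) (row j v).
have fact_neq0 : ((k * 2)`!%:R : R) != 0 by rewrite pnatr_eq0 -lt0n fact_gt0.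
pose up (r : 'S_(k * 2)) : 'S_(k.+1 * 2) :=
  lift_perm ord0 ord0 (lift_perm ord0 ord0 r).
transitivity ((2`!%:R * (k * 2)`!%:R)^-1 * (2^-1 ^+ k *
    \sum_(r : 'S_(k * 2)) \sum_(s : 'S_(k.+1 * 2)) pfterm b (up r * s)%g)).
  rewrite /= /wedge; congr (_ * _).
  rewrite exchange_big mulr_sumr; apply: eq_bigr => s _ /=.
  rewrite etaE IH !mulr_sumr; apply: eq_bigr => r _.
  rewrite [B _ _ * _]mulrCA [LHS]mulrCA; congr (_ * _).
  rewrite /pfterm odd_permM !odd_lift_perm /= addbC signr_addb -!mulrA.
  congr (_ * _); rewrite mulrCA; congr (_ * _).
  rewrite big_ord_recl; congr (_ * _).
    rewrite /b lo_ord0 hi_ord0 !permM /up lift_perm_lift !lift_perm_id.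
    by congr (B _ _); apply/rowP => l; rewrite !mxE; congr (v (s _) _); apply: val_inj.
  apply: eq_bigr => i _; rewrite /b lo_lift hi_lift !permM /up !lift_perm_lift.
  by congr (B _ _); apply/rowP => l; rewrite !mxE; congr (v (s _) _); apply: val_inj.
rewrite (eq_bigr (fun=> pfsum b)) => [|r _]; last first.
  by rewrite /pfsum [RHS](reindex_inj (mulgI (up r))).
rewrite sumr_const card_Sn -mulr_natl exprS; field.
by rewrite fact_neq0 pnatr_eq0.
Qed.

#[local] Arguments wedge_pow {R m} eta k : simpl never.

Hypothesis BN : forall x y, B x y = - B y x.

(** Serves twice: it evaluates powers on frames, and its right-hand side has the shape of [ext_d] of
    a function times a constant form. *)
Lemma wedge_pow_expand k t (v : 'M[R]_(k.+1 * 2, m)) :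
  wedge_pow eta k.+1 t v = k.+1%:R *
    \sum_(j < (k * 2).+1) (-1) ^+ j * B (row ord0 v) (row (lift ord0 j) v) *
      wedge_pow eta k t (row' j (row' ord0 v)).
Proof.
rewrite wedge_powE pfsum_expand // -(mulr_natl _ (k.+1 * 2)) natrM exprS.
have -> (a b c d : R) : a^-1 * b * (c * a * d) = c * (b * d) * (a^-1 * a) by ring.
rewrite mulVf ?pnatr_eq0 // mulr1; congr (_ * _).
rewrite mulr_sumr; apply: eq_bigr => j _; rewrite wedge_powE mulrCA.
congr (_ * (_ * _)); apply: eq_pfsum => i i'.
by congr (B _ _); apply/rowP => l; rewrite !mxE.
Qed.

Lemma wedge_pow_isolated k t (v : 'M[R]_(k * 2, m)) (c : 'I_(k * 2)) :
  (forall i, i != c -> B (row c v) (row i v) = 0) -> wedge_pow eta k t v = 0.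
Proof.
by move=> Bc; rewrite wedge_powE (@pfsum_isolated _ _ _ c) ?mulr0.
Qed.

(** Swapping the equal rows both fixes and negates the Pfaffian sum, which is therefore 0 as 2 is
    invertible. *)
Lemma wedge_pow_alternating k t : alternating (wedge_pow eta k t).
Proof.
move=> v i j ij rij; rewrite wedge_powE.
suff -> : pfsum (fun i j => B (row i v) (row j v)) = 0 by rewrite mulr0.
set b := fun i j => _.
have := pfsum_perm b (tperm i j); rewrite odd_tperm ij expr1 mulN1r.
rewrite (@eq_pfsum _ _ _ b) => [bN|x y]; first by lra.
have rt x' : row (tperm i j x') v = row x' v by case: tpermP => // ->.
by rewrite /b !rt.
Qed.

(** The hypothesis is a disjunction for each j because a frame with one perturbed vector satisfies
    neither alternative uniformly. *)
Lemma wedge_pow_pair k t (v : 'M[R]_(k.+1 * 2, m)) (x := row ord0 v)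
    (w : 'M[R]_(k * 2, m) := row' ord0 (row' ord0 v)) (y := row (lift ord0 ord0) v) :
  (forall j : 'I_(k * 2), B x (row j w) = 0 \/
    forall i : 'I_(k * 2), i != j -> B y (row i w) = 0) ->
  wedge_pow eta k.+1 t v = k.+1%:R * B x y * wedge_pow eta k t w.
Proof.
move: v @x @w @y; case: k => [|k] v x w y xyw;
  rewrite wedge_pow_expand big_ord_recl expr0 mul1r -/x -/y.
  by rewrite (big_ord0 _ _ (fun=> _)) addr0 mulrA mul1r.
rewrite big1 ?addr0 => [|j _]; first by rewrite mulrA.
have rj : row (lift ord0 (lift ord0 j)) v = row j w.
  by apply/rowP => l; rewrite !mxE.
rewrite rj; case: (xyw j) => [->|yw]; first by rewrite mulr0 mul0r.
(* Once x and the j-th row of w are deleted, y is the first remaining row and is orthogonal to all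
   others. *)
rewrite (@wedge_pow_isolated _ _ _ (ord0 : 'I_(k.+1 * 2))) ?mulr0 // => i i0.
have [l ->] : exists l : 'I_(k * 2).+1, i = lift ord0 l.
  by case: (unliftP ord0 i) i0 => [l ->|->]; [exists l|rewrite eqxx].
rewrite [row ord0 _](_ : _ = y); last first.
  by apply/rowP => h; rewrite !mxE; congr (v _ _); apply: val_inj.
rewrite [row (lift _ _) _](_ : _ = row (lift j l) w) ?yw // 1?eq_sym ?neq_lift //.
apply/rowP => h; rewrite !mxE; congr (v (lift _ _) _); apply: val_inj => /=.
by rewrite /bump !leq0n !add1n ltnS addnS.
Qed.

(** Indexing the vectors by [nat] lets a frame lose its first pair by mere composition with
    [addn 2]. *)
Definition mx_of k (F : nat -> 'rV[R]_m) : 'M[R]_(k * 2, m) :=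
  \matrix_(i < k * 2) F i.

Definition symplectic_frame k (F : nat -> 'rV[R]_m) := forall i j,
  (i < j < k * 2)%N -> B (F i) (F j) = (~~ odd i && (j == i.+1))%:R.

Lemma symplectic_frame_tail k F :
  symplectic_frame k.+1 F -> symplectic_frame k (F \o addn 2).
Proof.
move=> fF i j ij; rewrite /comp fF; last by lia.
by rewrite !add2n /= negbK.
Qed.

Lemma wedge_pow_mx_of_pair k t F :
  (forall j, (j < k * 2)%N -> B (F 0) (F j.+2) = 0 \/
    forall i, (i < k * 2)%N -> i != j -> B (F 1) (F i.+2) = 0) ->
  wedge_pow eta k.+1 t (mx_of k.+1 F) =
  k.+1%:R * B (F 0) (F 1) * wedge_pow eta k t (mx_of k (F \o addn 2)).
Proof.
move=> FF; have rw l : row l (row' ord0 (row' ord0 (mx_of k.+1 F))) = F l.+2.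
  by apply/rowP => h; rewrite !mxE.
rewrite wedge_pow_pair !rowK //=; last first.
  move=> j; rewrite rw; case: (FF j (ltn_ord j)) => [|F1]; first by left.
  by right=> i ij; rewrite rw F1.
congr (_ * wedge_pow eta k t _); apply/row_matrixP => l; rewrite rw rowK.
by rewrite /= add2n.
Qed.

Lemma wedge_pow_frame k t F :
  symplectic_frame k F -> wedge_pow eta k t (mx_of k F) = k`!%:R.
Proof.
elim: k F => [//|k IH] F fF.
rewrite wedge_pow_mx_of_pair => [|j jk]; last by left; rewrite fF //; lia.
by rewrite IH ?fF ?mulr1 -?natrM //; exact: symplectic_frame_tail.
Qed.

Variable L : 'rV[R]_m -> 'rV[R]_m.

(** Peel off the first pair: perturbing [F 0] or [F 1] gives one of the two terms for a = 0;
    perturbing a later vector leaves the factor B (F 0) (F 1) = 1 and the induction hypothesis for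
    the tail. The factors [k.+1] build the factorial. *)
Lemma wedge_pow_frame_derivation k t F : symplectic_frame k F ->
  \sum_(i < k * 2) wedge_pow eta k t
    (set_row (mx_of k F) i (L (row i (mx_of k F)))) =
  k`!%:R * \sum_(a < k) (B (L (F a.*2)) (F a.*2.+1) + B (F a.*2) (L (F a.*2.+1))).
Proof.
have E k' F' (i : 'I_(k' * 2)) :
    set_row (mx_of k' F') i (L (row i (mx_of k' F'))) =
    mx_of k' (fun l => if l == i then L (F' l) else F' l).
  apply/row_matrixP => l; rewrite rowK; apply/rowP => h; rewrite !mxE.
  by rewrite -val_eqE; case: eqP => // ->.
under eq_bigr do rewrite E.
elim: k F => [|k IH] F fF; first by rewrite !big_ord0 mulr0.
have Ft := symplectic_frame_tail fF; have vF := wedge_pow_frame t Ft.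
have F1 i : (i < k * 2)%N -> B (F 1) (F i.+2) = 0.
  by move=> ik; rewrite fF //; lia.
have F0 i : (i < k * 2)%N -> B (F 0) (F i.+2) = 0.
  by move=> ik; rewrite fF //; lia.
have F01 : B (F 0) (F 1) = 1 by rewrite fF.
rewrite big_ord_recl wedge_pow_mx_of_pair /= => [|j jk]; last first.
  by right => i ik _; exact: F1.
rewrite (_ : mx_of k _ = mx_of k (F \o addn 2)) // vF.
rewrite big_ord_recl wedge_pow_mx_of_pair /= => [|j jk]; last by left; exact: F0.
rewrite (_ : mx_of k _ = mx_of k (F \o addn 2)) // vF.
have -> : \sum_(i < k * 2) wedge_pow eta k.+1 t (mx_of k.+1
      (fun l => if l == lift ord0 (lift ord0 i) then L (F l) else F l)) =
    k.+1%:R * \sum_(i < k * 2) wedge_pow eta k t (mx_of k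
      (fun l => if l == i then L (F l.+2) else F l.+2)).
  rewrite mulr_sumr; apply: eq_bigr => i _.
  rewrite wedge_pow_mx_of_pair /= ?F01 ?mulr1 // => j jk.
  (* [F 0] can pair nontrivially only with the perturbed vector j = i, and then [F 1] is orthogonal
     to all the others. *)
  have [->|ji] := eqVneq j i; last by left; rewrite /bump /= !add1n !eqSS (negPf ji) F0.
  by right=> i' i'k i'i; rewrite /bump /= !add1n !eqSS (negPf i'i) F1.
rewrite (IH (F \o addn 2)) // big_ord_recl /= factS natrM.
under [in RHS]eq_bigr do rewrite /bump /= add1n doubleS.
ring.
Qed.

End SymplecticPowers.
(** * Derivations preserving a power of the symplectic form *)

Section StandardSymplectic.
Local Open Scope ring_scope.
Variables (R : realType) (n : nat).
Implicit Types (x y z P Q : 'rV[R]_(n + n)) (a b c : 'I_n).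

Definition sympl x y : R := \sum_(i < n)
  (x 0 (lshift n i) * y 0 (rshift n i) - x 0 (rshift n i) * y 0 (lshift n i)).

Lemma symplN x y : sympl x y = - sympl y x.
Proof. by rewrite /sympl -sumrN; apply: eq_bigr => i _; ring. Qed.

Lemma symplPl (u : R) x y z : sympl (u *: x + y) z = u * sympl x z + sympl y z.
Proof.
rewrite /sympl mulr_sumr -big_split /=; apply: eq_bigr => i _.
by rewrite !mxE; ring.
Qed.

Lemma symplPr (u : R) x y z : sympl z (u *: x + y) = u * sympl z x + sympl z y.
Proof. by rewrite !(symplN z) symplPl; ring. Qed.

Lemma sum_perm2 (A : nmodType) (F : 'S_2 -> A) :
  \sum_(s : 'S_2) F s = F 1%g + F (tperm ord0 ord_max).
Proof.
have neq : tperm ord0 ord_max != 1%g :> 'S_2.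
  by apply/eqP => /permP/(_ ord0); rewrite tpermL perm1.
rewrite (bigD1 1%g) //= (bigD1 (tperm ord0 ord_max)) //= big1 ?addr0 // => s.
case/andP=> s1 st; have o2 (i : 'I_2) : i = ord0 \/ i = ord_max.
  by case: i => -[|[|//]] ?; [left|right]; apply: val_inj.
case: (o2 (s ord0)) (o2 (s ord_max)) => s0 [] sm.
- by have /eqP := etrans s0 (esym sm); rewrite (inj_eq perm_inj).
- by case/eqP: s1; apply/permP => i; rewrite perm1; case: (o2 i) => ->.
- by case/eqP: st; apply/permP => i; case: (o2 i) => ->; rewrite ?tpermL ?tpermR.
- by have /eqP := etrans s0 (esym sm); rewrite (inj_eq perm_inj).
Qed.

Lemma std_sympE t (v : 'M_(2, n + n)) :
  @std_symp R n t v = sympl (row ord0 v) (row ord_max v).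
Proof.
rewrite /std_symp !fct_sumE; apply: eq_bigr => i _.
rewrite /wedge (sum_perm2 (fun s : 'S_(1 + 1) => _)) odd_perm1 odd_tperm.
rewrite mulr1 invr1 mul1r expr0 mul1r expr1 mulN1r /dcoord !mxE !perm1.
rewrite (_ : lshift 1 0 = ord0); last exact: val_inj.
rewrite (_ : rshift 1 0 = ord_max); last exact: val_inj.
by rewrite tpermL tpermR [v ord_max _ * _]mulrC.
Qed.

Definition p_ a : 'rV[R]_(n + n) := delta_mx 0 (lshift n a).
Definition q_ a : 'rV[R]_(n + n) := delta_mx 0 (rshift n a).

Lemma sympl_p a y : sympl (p_ a) y = y 0 (rshift n a).
Proof.
rewrite /sympl (bigD1 a) //= big1 => [|i ia]; rewrite !mxE !eqxx eq_rlshift /=.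
  by rewrite mul1r mul0r subr0 addr0.
by rewrite (inj_eq (@lshift_inj _ _)) (negPf ia) !mul0r subr0.
Qed.

Lemma sympl_q a y : sympl (q_ a) y = - y 0 (lshift n a).
Proof.
rewrite /sympl (bigD1 a) //= big1 => [|i ia]; rewrite !mxE !eqxx eq_lrshift /=.
  by rewrite mul1r mul0r sub0r addr0.
by rewrite (inj_eq (@rshift_inj _ _)) (negPf ia) !mul0r subr0.
Qed.

Lemma sympl_pp a b : sympl (p_ a) (p_ b) = 0.
Proof. by rewrite sympl_p mxE eq_rlshift. Qed.

Lemma sympl_qq a b : sympl (q_ a) (q_ b) = 0.
Proof. by rewrite sympl_q mxE eq_lrshift oppr0. Qed.

Lemma sympl_pq a b : sympl (p_ a) (q_ b) = (a == b)%:R.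
Proof. by rewrite sympl_p mxE eqxx (inj_eq (@rshift_inj _ _)). Qed.

Lemma sympl_qp a b : sympl (q_ a) (p_ b) = - (a == b)%:R.
Proof. by rewrite symplN sympl_pq eq_sym. Qed.

Lemma linear_delta0 m (f : 'rV[R]_m -> R) :
  (forall (u : R) (x y : 'rV[R]_m), f (u *: x + y) = u * f x + f y) ->
  (forall i, f (delta_mx 0 i) = 0) -> forall x : 'rV[R]_m, f x = 0.
Proof.
move=> fP f0 x; rewrite (row_sum_delta x).
have f00 : f 0 = 0 by have := fP (-1) 0 0; rewrite scaler0 addr0; lra.
elim/big_ind: _ => // [y z fy fz|i _].
  by rewrite -[y]scale1r fP fy fz mulr0 addr0.
by rewrite -[_ *: _]addr0 fP f0 f00 mulr0 addr0.
Qed.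

Section Derivation.
Variable L : 'rV[R]_(n + n) -> 'rV[R]_(n + n).
Hypothesis LP : forall (u : R) x y, L (u *: x + y) = u *: L x + L y.

(** When L is the derivative of X at a point, this is both the Lie derivative of omega along X and
    the exterior derivative of i_X omega. *)
Definition symplD x y := sympl (L x) y + sympl x (L y).

Lemma symplDN x y : symplD x y = - symplD y x.
Proof. by rewrite /symplD (symplN y) (symplN (L y)); ring. Qed.

Lemma symplDPl (u : R) x y z : symplD (u *: x + y) z = u * symplD x z + symplD y z.
Proof. by rewrite /symplD LP !symplPl; ring. Qed.

Lemma symplDDl x y z : symplD (x + y) z = symplD x z + symplD y z.
Proof. by rewrite -[x]scale1r symplDPl !scale1r mul1r. Qed.

Lemma symplDDr x y z : symplD z (x + y) = symplD z x + symplD z y.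
Proof. by rewrite !(symplDN z) symplDDl; ring. Qed.

Variables (k : nat) (t : torus R (n + n)).
Hypothesis lt_kn : (k.+1 < n)%N.
Hypothesis derivation0 : forall v : 'M[R]_(k.+1 * 2, n + n),
  \sum_(i < k.+1 * 2)
    wedge_pow (@std_symp R n) k.+1 t (set_row v i (L (row i v))) = 0.

(** P, Q and the pairs p_c, q_c for c in s form a symplectic frame, so the derivation formula
    applies and its factorial is invertible. *)
Lemma symplD_pair (s : seq 'I_n) P Q : uniq s -> size s = k ->
  sympl P Q = 1 ->
  {in s, forall c, [/\ sympl P (p_ c) = 0, sympl P (q_ c) = 0,
    sympl Q (p_ c) = 0 & sympl Q (q_ c) = 0]} ->
  symplD P Q + \sum_(c <- s) symplD (p_ c) (q_ c) = 0.
Proof.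
move=> us sk PQ PQs; have n0 : 'I_n by exists 0%N; lia.
(* Interleaves the p_c and q_c; [n0] is only the default of [nth]. *)
pose e i := if odd i then q_ (nth n0 s (i %/ 2)) else p_ (nth n0 s (i %/ 2)).
pose F i := match i with 0 => P | 1 => Q | i.+2 => e i end.
have fF : symplectic_frame sympl k.+1 F.
  move=> [|[|i]] [|[|j]] // ij; rewrite /F ?PQ //.
  - have /PQs[Pp Pq _ _] : nth n0 s (j %/ 2) \in s by apply: mem_nth; rewrite sk; lia.
    by rewrite /e; case: odd.
  - have /PQs[_ _ Pp Pq] : nth n0 s (j %/ 2) \in s by apply: mem_nth; rewrite sk; lia.
    by rewrite /e; case: odd.
  have -> : odd i.+2 = odd i by rewrite /= negbK.
  rewrite !eqSS /e.
  have [oi|oi] := boolP (odd i); have [oj|oj] := boolP (odd j); rewrite /=.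
  - exact: sympl_qq.
  - by rewrite sympl_qp nth_uniq ?sk; try lia; case: eqP => //=; [lia|rewrite oppr0].
  - rewrite sympl_pq nth_uniq ?sk; try lia; congr (_ %:R).
    by do 2![case: eqP => //=]; lia.
  - rewrite sympl_pp; case: eqP => //= ji; lia.
have := wedge_pow_frame_derivation std_sympE symplN L t fF.
rewrite derivation0 => /esym/eqP; rewrite mulf_eq0 pnatr_eq0 -leqn0 leqNgt fact_gt0 /=.
rewrite big_ord_recl => /eqP; apply: etrans; congr (_ + _).
rewrite (big_nth n0) big_mkord sk; apply: eq_bigr => i _.
have -> : (lift ord0 i).*2 = i.*2.+2 by rewrite lift0 doubleS.
rewrite /F /e /= odd_double /=.
have -> : (i.*2 %/ 2 = i)%N by rewrite -muln2 mulnK.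
by have -> : (i.*2.+1 %/ 2 = i)%N by rewrite -muln2 -addn1 divnMDl // addn0.
Qed.

(** Varying one hyperbolic pair against fixed other planes kills the off-diagonal values and equates
    the diagonal ones; a full frame then kills the diagonal. *)
Lemma symplD_eq0 x y : symplD x y = 0.
Proof.
(* Discarding two of the n indices leaves at least n - 2 of them, and n - 2 is at least k because
   [k.+1 < n]. *)
have avoid a b : a != b -> exists s : seq 'I_n,
    [/\ uniq s, size s = k, a \notin s & b \notin s].
  move=> ab; pose r := seq.filter (predC (pred2 a b)) (enum 'I_n).
  exists (take k r).
  have notin c : pred2 a b c -> c \notin take k r.
    by move=> cab; apply/negP => /mem_take; rewrite mem_filter => /andP[/negP[]].
  split; rewrite ?notin //= ?eqxx ?orbT //.
    exact/take_uniq/filter_uniq/enum_uniq.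
  rewrite size_takel // size_filter.
  rewrite -(leq_add2l (count (pred2 a b) (enum 'I_n))) count_predC size_enum_ord.
  have c2 : (count (pred2 a b) (enum 'I_n) <= 2)%N.
    rewrite -[2%N]/(size [:: a; b]) -size_filter uniq_leq_size //.
      exact/filter_uniq/enum_uniq.
    by move=> c; rewrite mem_filter !inE => /andP[].
  by apply: leq_trans (leq_add c2 (leqnn k)) _; lia.
have ortho a b (s : seq 'I_n) : a \notin s -> {in s, forall c,
    [/\ sympl (p_ a) (p_ c) = 0, sympl (p_ a) (q_ c) = 0,
      sympl (q_ a) (p_ c) = 0 & sympl (q_ a) (q_ c) = 0]}.
  move=> aN c cs; have ac : (a == c) = false by apply: contraNF aN => /eqP ->.
  by rewrite sympl_pp sympl_pq sympl_qp sympl_qq ac oppr0.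
have orthoD x1 x2 z : sympl x1 z = 0 -> sympl x2 z = 0 -> sympl (x1 + x2) z = 0.
  by move=> z1 z2; rewrite -[x1]scale1r symplPl z1 z2 mulr0 addr0.
(* For one s, the pairs (p_a, q_a), (p_b, q_b), (p_a + p_b, q_a), (p_a + q_b, q_a) and (p_a, q_a +
   p_b) all complete to frames; comparing each relation with the first isolates one value. *)
have PQD a b : a != b -> [/\ symplD (p_ a) (q_ a) = symplD (p_ b) (q_ b),
    symplD (p_ b) (q_ a) = 0, symplD (q_ b) (q_ a) = 0 & symplD (p_ a) (p_ b) = 0].
  move=> ab; have [s [us sk aN bN]] := avoid a b ab.
  have D P Q := @symplD_pair s P Q us sk.
  have oa := ortho a b s aN; have ob := ortho b a s bN.
  have Da : symplD (p_ a) (q_ a) + \sum_(c <- s) symplD (p_ c) (q_ c) = 0.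
    by apply: D => //; rewrite sympl_pq eqxx.
  have ba : (b == a) = false by rewrite eq_sym (negPf ab).
  split.
  - apply: (addIr (\sum_(c <- s) symplD (p_ c) (q_ c))); rewrite Da D //.
    by rewrite sympl_pq eqxx.
  - have: symplD (p_ a + p_ b) (q_ a) + \sum_(c <- s) symplD (p_ c) (q_ c) = 0;
      first apply: D.
    + by rewrite -[p_ a]scale1r symplPl !sympl_pq eqxx ba mulr1 addr0.
    + by move=> c cs; have [? ? ? ?] := oa c cs; have [? ? ? ?] := ob c cs;
        split=> //; exact: orthoD.
    by move: Da; rewrite ?symplDDl ?symplDDr; lra.
  - have: symplD (p_ a + q_ b) (q_ a) + \sum_(c <- s) symplD (p_ c) (q_ c) = 0;
      first apply: D.
    + by rewrite -[p_ a]scale1r symplPl sympl_pq sympl_qq eqxx mulr1 addr0.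
    + by move=> c cs; have [? ? ? ?] := oa c cs; have [? ? ? ?] := ob c cs;
        split=> //; exact: orthoD.
    by move: Da; rewrite ?symplDDl ?symplDDr; lra.
  - have: symplD (p_ a) (q_ a + p_ b) + \sum_(c <- s) symplD (p_ c) (q_ c) = 0;
      first apply: D.
    + by rewrite -[q_ a]scale1r symplPr sympl_pq sympl_pp eqxx mulr1 addr0.
    + by move=> c cs; have [? ? ? ?] := oa c cs; have [? ? ? ?] := ob c cs;
        split=> //; exact: orthoD.
    by move: Da; rewrite ?symplDDl ?symplDDr; lra.
(* All k + 1 diagonal values in the relation agree, so k + 1 times one of them is 0. *)
have diag a : symplD (p_ a) (q_ a) = 0.
  have [b ab] : exists b, a != b.
    have : (1 < #|'I_n|)%N by rewrite card_ord; lia.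
    by case/card_gt1P => b [c [_ _ bc]]; have [->|] := eqVneq a b; [exists c|exists b].
  have [s [us sk aN bN]] := avoid a b ab.
  have := @symplD_pair s (p_ a) (q_ a) us sk; rewrite sympl_pq eqxx.
  move=> /(_ erefl (ortho a b s aN)).
  rewrite (eq_big_seq (fun=> symplD (p_ a) (q_ a))) => [|c cs]; last first.
    have ac : a != c by apply: contraNneq aN => ->.
    by have [->] := PQD a c ac.
  rewrite big_const_seq count_predT sk iter_addr_0 -mulrS -mulr_natl => /eqP.
  by rewrite mulf_eq0 pnatr_eq0 => /eqP.
have skew0 u : symplD u u = 0 by have := symplDN u u; lra.
have basis u w : symplD (delta_mx 0 u) (delta_mx 0 w) = 0.
  case: (split_ordP u) => a ->; case: (split_ordP w) => b ->;
    rewrite -?/(p_ _) -?/(q_ _); have [->|ab] := eqVneq a b; rewrite ?skew0 ?diag //.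
  - by case: (PQD _ _ ab).
  - by rewrite eq_sym in ab; case: (PQD _ _ ab).
  - by rewrite symplDN diag oppr0.
  - by rewrite symplDN; case: (PQD _ _ ab) => _ ->; rewrite oppr0.
  - by rewrite eq_sym in ab; case: (PQD _ _ ab).
have basisr u w : symplD u (delta_mx 0 w) = 0.
  apply: (linear_delta0 (f := fun z => symplD z (delta_mx 0 w))) => [c z z'|i].
    exact: symplDPl.
  exact: basis.
apply: (linear_delta0 (f := fun z => symplD z y)) => [c z z'|i].
  exact: symplDPl.
by rewrite symplDN basisr oppr0.
Qed.

End Derivation.

End StandardSymplectic.

(** * Smooth functions on the torus and null means *)

Section SmoothMaps.
Local Open Scope ring_scope.
Local Open Scope classical_set_scope.
Variable R : realType.

Lemma iter_derive_rcons (V W : normedModType R) (vs : seq V) v (f : V -> W) :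
  iter_derive (rcons vs v) f = iter_derive vs ('D_v f).
Proof. by rewrite /iter_derive foldr_rcons. Qed.

Lemma smooth_derive (V W : normedModType R) v (f : V -> W) :
  smooth f -> smooth ('D_v f).
Proof. by move=> sf vs x; rewrite -iter_derive_rcons; exact: sf. Qed.

(** [iter_derive] applies the last vector of the list first, hence the case analysis from the
    right. *)
Lemma derive_smooth (V W : normedModType R) (f : V -> W) :
  (forall x, differentiable f x) -> (forall v, smooth ('D_v f)) -> smooth f.
Proof.
move=> df sf; elim/last_ind => [|vs v _] x; first exact: df.
by rewrite iter_derive_rcons; exact: sf.
Qed.

Lemma smooth_continuous (V W : normedModType R) (f : V -> W) :
  smooth f -> continuous f.
Proof. by move=> sf x; apply: differentiable_continuous; exact: (sf [::]). Qed.

Lemma derive_linear_comp (V W W' : normedModType R) (l : {linear W -> W'})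
    (f : V -> W) v : continuous l -> smooth f -> 'D_v (l \o f) = l \o 'D_v f.
Proof.
move=> cl sf; apply/funext => x; have df : differentiable f x by exact: (sf [::]).
have dl : differentiable l (f x) by exact: linear_differentiable.
rewrite deriveE; last exact: differentiable_comp.
by rewrite diff_comp //= diff_lin // deriveE.
Qed.

Lemma smooth_linear_comp (V W W' : normedModType R) (l : {linear W -> W'})
    (f : V -> W) : continuous l -> smooth f -> smooth (l \o f).
Proof.
move=> cl sf.
suff E vs : iter_derive vs (l \o f) = l \o iter_derive vs f.
  move=> vs x; rewrite E; apply: differentiable_comp; first exact: sf.
  exact: linear_differentiable.
elim: vs => [//|v vs IH] /=; rewrite IH derive_linear_comp //.
by move=> us x; rewrite /iter_derive -foldr_cat; exact: sf.
Qed.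

Lemma derive_linear (V W : normedModType R) (f : V -> W) (a : R) (v w x : V) :
  smooth f -> 'D_(a *: v + w) f x = a *: 'D_v f x + 'D_w f x.
Proof.
move=> sf; have df : differentiable f x by exact: (sf [::]).
by rewrite !deriveE // linearP.
Qed.

Lemma derive_scale (V W : normedModType R) (f : V -> W) (a : R) (v x : V) :
  smooth f -> 'D_(a *: v) f x = a *: 'D_v f x.
Proof. by move=> sf; rewrite -[a *: v]addr0 derive_linear // derive0 addr0. Qed.

Lemma is_derive_line (V : normedModType R) (g : V -> R) (x w : V) (s : R) :
  derivable g (x + s *: w) w ->
  is_derive s 1 (fun r : R => g (x + r *: w)) ('D_w g (x + s *: w)).
Proof.
move=> dg; set phi := fun r : R => g (x + r *: w).
suff E : (fun h : R => h^-1 *: ((phi \o shift s) (h *: 1) - phi s)) =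
    (fun h => h^-1 *: ((g \o shift (x + s *: w)) (h *: w) - g (x + s *: w))).
  by split; rewrite /derivable /derive E.
apply/funext => h; congr (_ *: (g _ - _)) => /=.
by rewrite [h *: 1]mulr1 scalerDl addrCA.
Qed.

Lemma line_MVT (V : normedModType R) (g : V -> R) (x w : V) : smooth g ->
  exists2 s : R, 0 < s < 1 & g (x + w) - g x = 'D_w g (x + s *: w).
Proof.
move=> sg; pose phi (r : R) := g (x + r *: w).
have dphi (s : R) : is_derive s 1 phi ('D_w g (x + s *: w)).
  by apply: is_derive_line; exact: smooth_derivable.
have cphi : {within `[0, 1 : R], continuous phi}.
  apply: continuous_subspaceT => r; apply: differentiable_continuous.
  by apply/derivable1_diffP; case: (dphi r).
have [s s01] := MVT ltr01 (fun r _ => dphi r) cphi.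
rewrite subr0 mulr1 /phi scale1r scale0r addr0 => E.
by exists s => //; rewrite in_itv /= in s01.
Qed.

(** The mean value theorem applied twice; it gives C instead of C / 2, which is enough. *)
Lemma line_Taylor (V : normedModType R) (g : V -> R) (x w : V) (C : R) :
  smooth g -> (forall y, `|'D_w ('D_w g) y| <= C) ->
  `|g (x + w) - g x - 'D_w g x| <= C.
Proof.
move=> sg gC; have [s /andP[s0 s1] ->] := line_MVT x w sg.
have [r _ ->] := line_MVT x (s *: w) (smooth_derive w sg).
rewrite derive_scale; last exact: smooth_derive.
rewrite normrZ -[leRHS]mul1r.
by apply: ler_pM => //; rewrite gtr0_norm // ltW.
Qed.

End SmoothMaps.

Section NullMeans.
Local Open Scope ring_scope.
Local Open Scope classical_set_scope.
Variables (R : realType) (V : normedModType R).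
Implicit Types (f g : V -> R) (s : seq V).

Definition translate_mean s f x : R := (size s)%:R^-1 * \sum_(a <- s) f (x + a).

(** Stands for a vanishing integral over the torus: some finite average of translates is uniformly
    small. *)
Definition null_mean f := forall e, 0 < e ->
  exists2 s, s != [::] & forall x, `|translate_mean s f x| <= e.

(* Translation means commute, so null means are closed under sums even though
   the two summands use different translates. *)
Lemma translate_meanC s s' f x :
  translate_mean s (translate_mean s' f) x = translate_mean s' (translate_mean s f) x.
Proof.
rewrite /translate_mean -!mulr_sumr [in RHS]exchange_big /= mulrCA.
by congr (_ * (_ * _)); do 2![apply: eq_bigr => ? _]; rewrite addrAC.
Qed.

Lemma translate_meanD s f g x :
  translate_mean s (f \+ g) x = translate_mean s f x + translate_mean s g x.
Proof. by rewrite /translate_mean -mulrDr -big_split. Qed.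

Lemma translate_mean_le s f e x : s != [::] ->
  (forall y, `|f y| <= e) -> `|translate_mean s f x| <= e.
Proof.
move=> s0 fe; have ls0 : 0 < (size s)%:R :> R by rewrite ltr0n lt0n size_eq0.
rewrite normrM gtr0_norm ?invr_gt0 // mulrC ler_pdivrMr //.
apply: le_trans (ler_norm_sum _ _ _) _.
apply: (@le_trans _ _ (\sum_(a <- s) e)); first exact: ler_sum.
by rewrite big_const_seq count_predT iter_addr_0 mulr_natr.
Qed.

Lemma null_meanD f g : null_mean f -> null_mean g -> null_mean (f \+ g).
Proof.
move=> nf ng e e0; have e20 : 0 < e / 2 by rewrite divr_gt0.
have [s s0 fs] := nf _ e20; have [s' s'0 gs] := ng _ e20.
exists [seq a + b | a <- s, b <- s'].
  by rewrite -size_eq0 size_allpairs muln_eq0 !size_eq0 (negPf s0) (negPf s'0).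
have E h x : translate_mean [seq a + b | a <- s, b <- s'] h x =
    translate_mean s (translate_mean s' h) x.
  rewrite /translate_mean size_allpairs natrM invfM -mulrA; congr (_ * _).
  rewrite big_allpairs_dep -mulr_sumr; congr (_ * _).
  by do 2![apply: eq_bigr => ? _]; rewrite addrA.
move=> x; rewrite E [translate_mean s' _](_ : _ =
  translate_mean s' f \+ translate_mean s' g); last first.
  by apply/funext => y; rewrite translate_meanD.
rewrite translate_meanD (le_trans (ler_normD _ _)) // [leRHS]splitr lerD //.
  by rewrite translate_meanC translate_mean_le.
exact: translate_mean_le.
Qed.

Lemma null_meanZ c f : null_mean f -> null_mean (c \*o f).
Proof.
move=> nf e e0; have c0 : 0 < `|c| + 1 by rewrite ltr_wpDl.
have [s s0 fs] := nf (e / (`|c| + 1)) (divr_gt0 e0 c0); exists s => // x.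
rewrite /translate_mean -mulr_sumr mulrCA normrM.
apply: (@le_trans _ _ ((`|c| + 1) * (e / (`|c| + 1)))); last first.
  by rewrite mulrC divfK ?gt_eqF.
by apply: ler_pM => //; rewrite ?lerDl //; exact: fs.
Qed.

Lemma null_mean0 : null_mean (fun=> 0).
Proof.
move=> e e0; exists [:: 0] => // x.
by rewrite /translate_mean big1 // mulr0 normr0 ltW.
Qed.

Lemma null_mean_sum (I : Type) (r : seq I) (F : I -> V -> R) :
  (forall i, null_mean (F i)) -> null_mean (fun x => \sum_(i <- r) F i x).
Proof.
move=> nF; elim: r => [|i r IH].
  by under eq_fun do rewrite big_nil; exact: null_mean0.
by under eq_fun do rewrite big_cons; exact: null_meanD.
Qed.

Lemma null_mean_cst c : null_mean (fun=> c) -> c = 0.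
Proof.
move=> nc; apply/eqP; rewrite -normr_le0 leNgt; apply/negP => c0.
have [s s0] := nc (`|c| / 2) (divr_gt0 c0 (ltr0Sn R 1)); move=> /(_ 0).
rewrite /translate_mean big_const_seq count_predT iter_addr_0 -(mulr_natl c) mulKf.
  by lra.
by rewrite pnatr_eq0 size_eq0.
Qed.

(* The mean over N equidistant translates along a period is a telescoping sum
   up to an O(1/N) Taylor error. *)
Lemma null_mean_derive g v C : smooth g -> (forall x, g (x + v) = g x) ->
  (forall x, `|'D_v ('D_v g) x| <= C) -> null_mean ('D_v g).
Proof.
move=> sg gv gC e e0.
pose N := (Num.truncn (C / e)).+1; have N0 : 0 < N%:R :> R by rewrite ltr0n.
have NC : C / N%:R <= e.
  rewrite ler_pdivrMr // mulrC -ler_pdivrMr //; exact/ltW/truncnS_gt.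
pose w := N%:R^-1 *: v.
exists [seq j%:R *: w | j <- iota 0 N] => // x.
rewrite /translate_mean size_map size_iota big_map -[iota 0 N]/(index_iota 0 N) big_mkord.
pose y (j : nat) := x + j%:R *: w.
have yS j : y j.+1 = y j + w by rewrite /y -natr1 scalerDl scale1r addrA.
have tel : \sum_(j < N) (g (y j.+1) - g (y j)) = 0.
  rewrite -(big_mkord xpredT (fun j => g (y j.+1) - g (y j))) telescope_sumr //.
  rewrite /y scale0r addr0 /w scalerA mulfV ?gt_eqF // scale1r gv subrr //.
have wC z : `|'D_w ('D_w g) z| <= C / N%:R ^+ 2.
  rewrite derive_scale; last exact: smooth_derive.
  rewrite (_ : 'D_w g = N%:R^-1 *: 'D_v g); last first.
    by apply/funext => u; rewrite derive_scale.
  rewrite deriveZ; last exact/smooth_derivable/smooth_derive.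
  rewrite scalerA normrZ [leRHS]mulrC; apply: ler_pM => //.
  by rewrite expr2 invfM ger0_norm // mulr_ge0 // invr_ge0 ltW.
(* N^-1 D_v is D_w, so the mean is a sum of N Taylor errors of size C / N^2. *)
rewrite mulr_sumr; under eq_bigr => j _ do rewrite -[_^-1 * _]/(_ *: _) -derive_scale //.
set S := \sum_(i < N) _.
have {S}-> : S = \sum_(j < N) ('D_w g (y j) - (g (y j.+1) - g (y j))).
  by rewrite sumrB tel subr0.
apply: le_trans NC; apply: le_trans (ler_norm_sum _ _ _) _.
 apply: (@le_trans _ _ (\sum_(j < N) C / N%:R ^+ 2)).
  apply: ler_sum => j _; rewrite distrC yS.
  exact: line_Taylor.
by rewrite sumr_const card_ord -(mulr_natr (C / _)) expr2 invfM mulrA divfK ?gt_eqF.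
Qed.

End NullMeans.

Section TorusFunctions.
Local Open Scope ring_scope.
Local Open Scope classical_set_scope.
Local Open Scope quotient_scope.
Variables (R : realType) (m : nat).
Notation torus := (torus R m).
Notation V := 'rV[R]_m.

Lemma delta_mx_lattice j : (delta_mx 0 j : V) \in @int_lattice R m.
Proof.
rewrite inE; apply/forallP => i; rewrite mxE eqxx /=.
by case: eqP; rewrite ?int_num1 ?int_num0.
Qed.

Lemma pi_torus_periodic (x z : V) : z \in @int_lattice R m ->
  \pi_torus (x + z) = \pi_torus x.
Proof.
by move=> zZ; apply/eqP; rewrite -Quotient.idealrBE addrAC subrr add0r.
Qed.

Lemma tderive_comp_pi (W : normedModType R) v (f : torus -> W) :
  tderive v f \o \pi_torus = 'D_v (f \o \pi_torus).
Proof. by apply/funext => x; exact: tderive_pi. Qed.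

Lemma tsmooth_tderive (W : normedModType R) v (f : torus -> W) :
  tsmooth f -> tsmooth (tderive v f).
Proof. by rewrite /tsmooth tderive_comp_pi; exact: smooth_derive. Qed.

Lemma tsmooth_bounded (f : torus -> R) :
  tsmooth f -> exists C, forall t, `|f t| <= C.
Proof.
move=> sf; pose K := [set x : V | forall i, `[0, 1]%classic (x ord0 i)].
have cK : compact K 
  by apply: (@rV_compact _ _ (fun=> `[0, 1 : R]%classic)) => i; exact: segment_compact.
have K0 : K !=set0 by exists 0 => i /=; rewrite mxE in_itv /= lexx ler01.
have cf : {within K, continuous (fun x : V => `|f (\pi_torus x)|)}.
  have cg : continuous (f \o \pi_torus : V -> R) by exact: smooth_continuous.
  apply: continuous_subspaceT => x.
  exact: (continuous_comp (cg x) (@norm_continuous _ _ _)).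
have [c _ fc] := EVT_max_rV K0 cK cf; exists `|f (\pi_torus c)| => t.
(* Subtracting integer parts moves the representative into the compact unit cube. *)
pose x : V := repr t; pose z : V := \row_j (Num.floor (x 0 j))%:~R.
have zZ : - z \in @int_lattice R m.
  by rewrite inE; apply/forallP => j; rewrite !mxE rpredN intr_int.
have -> : t = \pi_torus (x - z) by rewrite pi_torus_periodic // reprK.
apply: (fc (x - z)).
rewrite inE => i /=; rewrite !mxE in_itv /= subr_ge0 floor_le_tmp /=.
by rewrite lerBlDr addrC -(intrD _ _ 1) ltW // floorD1_gt.
Qed.

Lemma null_mean_tderive v (f : torus -> R) : v \in @int_lattice R m ->
  tsmooth f -> null_mean (tderive v f \o \pi_torus).
Proof.
move=> vZ sf; have [C fC] := tsmooth_bounded (tsmooth_tderive v (tsmooth_tderive v sf)).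
rewrite tderive_comp_pi; apply: (@null_mean_derive _ _ _ _ C sf) => x.
  by rewrite /= pi_torus_periodic.
by rewrite -tderive_comp_pi -tderive_pi.
Qed.

End TorusFunctions.

(** * Primitives of closed 1-forms *)

Section Primitives.
Local Open Scope ring_scope.
Local Open Scope classical_set_scope.
Variable R : realType.

(* I is the integral of g over [0, 1]; stating it through an antiderivative
   reduces linearity and estimates to the mean value theorem. *)
Definition is_int (g : R -> R) (I : R) := exists2 F : R -> R,
  (forall s : R, 0 <= s <= 1 -> is_derive s 1 F (g s)) & F 1 - F 0 = I.

Lemma is_int_linear c g h I J :
  is_int g I -> is_int h J -> is_int (fun s => c * g s + h s) (c * I + J).
Proof.
move=> [F dF <-] [G dG <-]; exists (c *: F + G); last first.
  by rewrite !fctE /GRing.scale /=; ring.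
move=> s s01; have ? := dF s s01; have ? := dG s s01.
by apply: is_derive_eq.
Qed.

Lemma is_int_le g I C : (forall s : R, 0 <= s <= 1 -> `|g s| <= C) ->
  is_int g I -> `|I| <= C.
Proof.
move=> gC [F dF <-].
have cF : {within `[0, 1 : R], continuous F}.
  apply: derivable_within_continuous => s; rewrite in_itv /= => s01.
  by case: (dF s s01).
have dF' (s : R) : s \in `]0, 1[%R -> is_derive s 1 F (g s).
  by rewrite in_itv /= => /andP[? ?]; apply: dF; rewrite !ltW.
have [s + ->] := MVT ltr01 dF' cF; rewrite subr0 mulr1 in_itv /= => /andP[? ?].
by apply: gC; rewrite !ltW.
Qed.

Lemma is_int_uniq g I J : is_int g I -> is_int g J -> I = J.
Proof.
move=> gI gJ; have : `|-1 * I + J| <= 0.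
  apply: is_int_le (is_int_linear (-1) gI gJ) => s _.
  by rewrite mulN1r addNr normr0.
by rewrite normr_le0 mulN1r addrC subr_eq0 => /eqP.
Qed.

Lemma is_int_continuous g : continuous g -> exists I, is_int g I.
Proof.
(* The integral starts at -1, and the fundamental theorem is used on [-1, 2], so that every s in
   [0, 1] is interior and F has a two-sided derivative even at the endpoints. *)
move=> cg; pose F x := (\int[lebesgue_measure]_(t in `[-1 : R, x]) g t)%R.
exists (F 1 - F 0); exists F => // s /andP[s0 s1].
have lt_s2 : s < 2 by lra.
have gi : lebesgue_measure.-integrable `[-1 : R, 2] (constructive_ereal.EFin \o g).
  apply: continuous_compact_integrable; first exact: segment_compact.
  exact: continuous_subspaceT.
have lt_1s : -1 < s by lra.
have [dF F's] := continuous_FTC1_closed lt_s2 gi lt_1s (cg s).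
split; first exact: dF.
by rewrite -derive1E F's.
Qed.

Lemma quadratic_differentiable (V W : normedModType R) (f : V -> W) (x : V)
    (l : {linear V -> W}) (K : R) : continuous l ->
  (forall w, `|f (x + w) - f x - l w| <= K * `|w| ^+ 2) ->
  differentiable f x /\ forall v, 'D_v f x = l v.
Proof.
move=> cl fK.
have E : f \o shift x = cst (f x) + l +o_0 id.
  apply/eqaddoP => _/posnumP[e].
  have e0 : 0 < e%:num / (`|K| + 1) by rewrite divr_gt0 // ltr_wpDl.
  have := @cvgr0_norm_le _ _ _ (nbhs (0 : V)) (nbhs_filter _) id cvg_id _ e0.
  apply: filter_app; near=> w => wK.
  rewrite !fctE /= opprD addrA [w + x]addrC (le_trans (fK w)) //.
  rewrite expr2 mulrA ler_wpM2r //.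
  apply: (@le_trans _ _ ((`|K| + 1) * `|w|)).
    by rewrite ler_wpM2r // (le_trans (ler_norm K)) // lerDl.
  by rewrite mulrC -ler_pdivlMr ?ltr_wpDl.
have dl := diff_unique cl E.
have df : differentiable f x by apply/diff_locallyP; rewrite dl.
by split=> // v; rewrite deriveE // dl.
Unshelve. all: by end_near. Qed.

Lemma coord_le_norm m (w : 'rV[R]_m) i : `|w 0 i| <= `|w|.
Proof.
by rewrite [leRHS]/Num.norm /= mx_normrE;
  apply: (le_bigmax _ (fun ij : 'I_1 * 'I_m => `|w ij.1 ij.2|) (0, i)).
Qed.

Definition row_pairing m (c : 'I_m -> R) (w : 'rV[R]_m) : R :=
  \sum_i w 0 i * c i.

Fact row_pairing_is_linear m (c : 'I_m -> R) : linear (row_pairing c : _ -> R^o).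
Proof.
move=> a u v; rewrite /row_pairing scaler_sumr -big_split /=.
by apply: eq_bigr => i _; rewrite !mxE mulrDl -mulrA.
Qed.
HB.instance Definition _ m (c : 'I_m -> R) :=
  GRing.isLinear.Build R 'rV[R]_m R^o *:%R (row_pairing c) (row_pairing_is_linear c).

Lemma row_pairing_le m (c : 'I_m -> R) w :
  `|row_pairing c w| <= `|w| * \sum_i `|c i|.
Proof.
rewrite /row_pairing mulr_sumr; apply: le_trans (ler_norm_sum _ _ _) _.
by apply: ler_sum => i _; rewrite normrM ler_wpM2r // coord_le_norm.
Qed.

Lemma row_pairing_continuous m (c : 'I_m -> R) :
  continuous (row_pairing c : 'rV[R]_m -> R^o).
Proof.
apply/bounded_linear_continuous/linear_boundedP; exists (\sum_i `|c i|).
split=> [|r rc w]; first exact: num_real.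
by rewrite (le_trans (row_pairing_le c w)) // mulrC ler_wpM2r // ltW.
Qed.

Lemma row_pairingE m (f : 'rV[R]_m -> R) :
  (forall a (u v : 'rV[R]_m), f (a *: u + v) = a * f u + f v) ->
  forall w, f w = row_pairing (fun i => f (delta_mx 0 i)) w.
Proof.
move=> fP w; have f0 : f 0 = 0 by have := fP (-1) 0 0; rewrite scaler0 addr0; lra.
rewrite {1}(row_sum_delta w) /row_pairing.
elim/big_rec2: _ => // i x y _ <-; exact: fP.
Qed.

End Primitives.

(** * Closed 1-forms with vanishing periods have primitives on the torus *)

Section LineIntegrals.
Local Open Scope ring_scope.
Local Open Scope classical_set_scope.
Local Open Scope quotient_scope.
Variables (R : realType) (m : nat).
Notation torus := (torus R m).
Notation V := 'rV[R]_m.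

(** A 1-form with the vector as first argument, so that [a v] is a function that [tderive]
    accepts. *)
Definition linear_family (a : V -> torus -> R) :=
  forall c u v t, a (c *: u + v) t = c * a u t + a v t.

Lemma linear_family_tderive (f : torus -> R) :
  tsmooth f -> linear_family (fun v => tderive v f).
Proof. by move=> sf c u v t; rewrite /tderive derive_linear. Qed.

(** The left-hand side is the absolute value of a quadratic form in w whose coefficients are smooth
    functions of t, bounded by compactness of the torus. *)
Lemma linear_family_derive_le (a : V -> torus -> R) : linear_family a ->
  (forall v, tsmooth (a v)) ->
  exists C, forall w t, `|tderive w (a w) t| <= C * `|w| ^+ 2.
Proof.
move=> aP sa.
have bnd i : exists C, forall w t, `|tderive w (a (delta_mx 0 i)) t| <= `|w| * C.
  pose d j := tderive (delta_mx 0 j : V) (a (delta_mx 0 i)).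
  have /choice[C dC] : forall j, exists C, forall t, `|d j t| <= C.
    by move=> j; apply/tsmooth_bounded/tsmooth_tderive.
  exists (\sum_j C j) => w t.
  have P c u v := linear_family_tderive (sa (delta_mx 0 i)) c u v t.
  have -> := row_pairingE (f := fun w => tderive w (a (delta_mx 0 i)) t) P w.
  apply: le_trans (row_pairing_le _ _) _; rewrite ler_wpM2l //.
  by apply: ler_sum => j _; exact: dC.
have [C aC] := choice bnd; exists (\sum_i C i) => w t.
have P c u v : tderive w (a (c *: u + v)) t = c * tderive w (a u) t + tderive w (a v) t.
  rewrite -[c * _]/(c *: _) -tderiveP //; congr (tderive w _ t).
  by apply/funext => s; rewrite aP.
have -> := row_pairingE (f := fun v => tderive w (a v) t) P w.
rewrite (le_trans (row_pairing_le _ _)) // expr2 mulrCA.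
rewrite ler_wpM2l // mulr_suml.
by apply: ler_sum => i _; rewrite mulrC aC.
Qed.

Variable a : V -> torus -> R.
Hypothesis aP : linear_family a.
Hypothesis sa : forall v, tsmooth (a v).
Hypothesis closed_a : forall u v t, tderive u (a v) t = tderive v (a u) t.

Lemma line_continuous x : continuous (fun s : R => a x (\pi_torus (s *: x))).
Proof.
move=> s; apply: (@continuous_comp _ _ _ (fun s : R => s *: x) (a x \o \pi_torus)).
  exact: scalel_continuous.
exact: smooth_continuous (sa x) _.
Qed.

(** The radial primitive of the Poincaré lemma, on the universal cover. *)
Definition line_int (x : V) : R :=
  sval (cid (is_int_continuous (@line_continuous x))).

Lemma line_intP x : is_int (fun s => a x (\pi_torus (s *: x))) (line_int x).
Proof. exact: svalP. Qed.

Let H := line_int.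
Let al v : V -> R := a v \o \pi_torus.

Lemma al_derive u v x : 'D_u (al v) x = tderive u (a v) (\pi_torus x).
Proof. by rewrite tderive_pi. Qed.

(* With r(s) the difference of the two line integrands and d/ds (s a_w(s x)),
   closedness turns D_x a_w into D_w a_x, so r(s) is a Taylor remainder. *)
Lemma line_int_quadratic x : exists K, forall w,
  `|H (x + w) - H x - a w (\pi_torus x)| <= K * `|w| ^+ 2.
Proof.
have [C1 aC1] := linear_family_derive_le (linear_family_tderive (sa x))
  (fun v => tsmooth_tderive v (sa x)).
have [C2 aC2] := linear_family_derive_le aP sa.
exists (C1 + C2) => w.
pose phi' (s : R) := al w (s *: x) + s * 'D_x (al w) (s *: x).
have phiI : is_int phi' (a w (\pi_torus x)).
  exists (fun s : R => s * al w (0 + s *: x)); last first.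
    by rewrite /al /= add0r scale1r mul1r mul0r subr0.
  move=> s _; have dal : derivable (al w) (0 + s *: x) x.
    exact: smooth_derivable (sa w).
  have ? := is_derive_line dal.
  rewrite (_ : (fun s : R => s * _) = id * (fun s : R => al w (0 + s *: x))) //.
  apply: is_derive_eq; rewrite /phi' add0r /GRing.scale /= mulr1 addrC //.
have I1 := is_int_linear (-1) (line_intP x) (line_intP (x + w)).
have := is_int_linear (-1) phiI I1.
rewrite (_ : -1 * _ + _ = H (x + w) - H x - a w (\pi_torus x)); last by rewrite /H; ring.
apply: is_int_le => s /andP[s0 s1].
have s2 : s ^+ 2 <= 1 by rewrite expr_le1.
pose y := s *: x.
have -> : -1 * phi' s + (-1 * a x (\pi_torus (s *: x)) +
      a (x + w) (\pi_torus (s *: (x + w)))) =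
    (al x (y + s *: w) - al x y - 'D_(s *: w) (al x) y) +
    (al w (y + s *: w) - al w y).
  have -> u : a (x + w) u = a x u + a w u by rewrite -[x]scale1r aP mul1r scale1r.
  rewrite scalerDr -/y.
  rewrite derive_scale; last exact: sa.
  rewrite [in RHS]al_derive closed_a -al_derive /phi' -/y /al /= /GRing.scale /=.
  by ring.
rewrite (le_trans (ler_normD _ _)) // mulrDl lerD //.
  apply: line_Taylor; first exact: sa.
  move=> z; rewrite (_ : 'D_(s *: w) (al x) = s *: 'D_w (al x)); last first.
    by apply/funext => u; rewrite derive_scale //; exact: sa.
  rewrite deriveZ; last exact/smooth_derivable/smooth_derive/sa.
  rewrite derive_scale; last exact/smooth_derive/sa.
  rewrite scalerA -expr2 normrZ ger0_norm ?exprn_ge0 // -[leRHS]mul1r.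
  rewrite ler_pM ?exprn_ge0 //.
  by rewrite -[al x]/(a x \o _) -tderive_comp_pi -tderive_pi.
have [r _ ->] := line_MVT y (s *: w) (sa w).
rewrite derive_scale; last exact: sa.
by rewrite normrZ ger0_norm // -[leRHS]mul1r al_derive ler_pM.
Qed.

Lemma line_int_derive x :
  differentiable H x /\ forall v, 'D_v H x = a v (\pi_torus x).
Proof.
have [K HK] := line_int_quadratic x.
have aE w : a w (\pi_torus x) = row_pairing (fun i => a (delta_mx 0 i) (\pi_torus x)) w.
  by apply: (row_pairingE (f := fun w => a w (\pi_torus x))) => c u v; exact: aP.
have [|dH HD] := quadratic_differentiable (@row_pairing_continuous _ _
  (fun i => a (delta_mx 0 i) (\pi_torus x))) (f := H) (x := x) (K := K).
  by move=> w; have := HK w; rewrite aE.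
by split=> // v; rewrite HD aE.
Qed.

Lemma line_int_smooth : smooth H.
Proof.
apply: derive_smooth => [x|v]; first by case: (line_int_derive x).
rewrite (_ : 'D_v H = a v \o \pi_torus); first exact: sa.
by apply/funext => x; case: (line_int_derive x) => _ ->.
Qed.

Lemma line_int0 : H 0 = 0.
Proof.
apply: is_int_uniq (line_intP 0) _.
exists (fun=> 0); last by rewrite subrr.
move=> s _; rewrite (_ : a 0 _ = 0); first exact: is_derive_cst.
by have := aP (-1) 0 0 (\pi_torus (s *: 0)); rewrite scaler0 addr0; lra.
Qed.

(** By periodicity the lifted form is the same along s x and along z + s x, so H has equal
    increments on both segments. *)
Lemma line_int_translate z x : z \in @int_lattice R m -> H (z + x) = H z + H x.
Proof.
move=> zZ; apply/eqP; rewrite -subr_eq0 -normr_le0.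
have dline (y : V) (s : R) :
    is_derive s 1 (fun r : R => H (y + r *: x)) (a x (\pi_torus (y + s *: x))).
  have [dH <-] := line_int_derive (y + s *: x).
  exact/is_derive_line/diff_derivable.
have I (y : V) : is_int (fun s : R => a x (\pi_torus (y + s *: x))) (H (y + x) - H y).
  by exists (fun r : R => H (y + r *: x)) => [s _|]; rewrite ?scale1r ?scale0r ?addr0.
have := is_int_linear (-1) (I 0) (I z).
have -> : -1 * (H (0 + x) - H 0) + (H (z + x) - H z) = H (z + x) - (H z + H x).
  by rewrite add0r line_int0; ring.
apply: is_int_le => s _; rewrite add0r [z + _]addrC pi_torus_periodic //.
by rewrite mulN1r addNr normr0.
Qed.

Hypothesis periods0 : forall j, H (delta_mx 0 j) = 0.

(** H is additive on the lattice, so it vanishes there once it vanishes on the generators. *)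
Lemma line_int_periodic x z : z \in @int_lattice R m -> H (x + z) = H x.
Proof.
move=> zZ; rewrite addrC line_int_translate //.
suff -> : H z = 0 by rewrite add0r.
have neZ j n : ((delta_mx 0 j : V) *+ n) \in @int_lattice R m.
  by rewrite rpredMn // delta_mx_lattice.
have Hn j n : H (delta_mx 0 j *+ n) = 0.
  elim: n => [|n IH]; first exact: line_int0.
  by rewrite mulrS line_int_translate ?delta_mx_lattice // IH periods0 addr0.
have HN y : y \in @int_lattice R m -> H y = 0 -> H (- y) = 0.
  by move=> yZ y0; have := line_int_translate (- y) yZ; rewrite subrr line_int0 y0 add0r.
rewrite (row_sum_delta z).
suff [] : (\sum_j z 0 j *: delta_mx 0 j : V) \in @int_lattice R m /\
  H (\sum_j z 0 j *: delta_mx 0 j) = 0 by [].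
apply: (big_ind (fun y => y \in @int_lattice R m /\ H y = 0)).
- by split; [exact: rpred0|exact: line_int0].
- move=> y y' [yZ y0] [y'Z y'0]; split; first exact: rpredD.
  by rewrite line_int_translate // y0 y'0 addr0.
- move=> j _; move: zZ; rewrite inE => /forallP/(_ j)/intrP[[n|n] ->].
    by rewrite -[X in X *: _]/(n%:R) scaler_nat.
  rewrite NegzE mulrNz -[n.+1%:~R]/(n.+1%:R) scaleNr scaler_nat.
  by rewrite rpredN; split; [|apply: HN].
Qed.

Lemma torus_primitive : exists2 h : torus -> R,
  tsmooth h & forall v t, tderive v h t = a v t.
Proof.
have E : (H \o repr) \o \pi_torus = H.
  apply/funext => x /=; set y := repr _.
  have yx : y - x \in @int_lattice R m.
    by rewrite Quotient.idealrBE; apply/eqP; rewrite reprK.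
  by rewrite -(subrKC x y) line_int_periodic.
exists (H \o repr); first by rewrite /tsmooth E; exact: line_int_smooth.
move=> v t; rewrite -[t]reprK tderive_pi E.
by case: (line_int_derive (repr t)) => _ ->.
Qed.

End LineIntegrals.

(** * Lower bound for de Rham cohomology *)

Section ConstantForms.
Local Open Scope ring_scope.
Local Open Scope quotient_scope.
Variables (R : realType) (m : nat).

(** The form dx_(f 0) /\ ... /\ dx_(f (p-1)); as a determinant it is visibly multilinear and
    alternating. *)
Definition det_form p (f : 'I_p -> 'I_m) : form R m p :=
  fun _ v => \det (\matrix_(i, j) v i (f j)).

Lemma det_form_closed p (f : 'I_p -> 'I_m) : closed_form (det_form f).
Proof.
split; last first.
  apply/funext => t; apply/funext => v; rewrite /ext_d big1 // => i _.
  by rewrite [tderive _ _ _]tderive_cst mulr0.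
split=> [t v i c u w|t v i j ij rij|v]; last exact: tsmooth_cst.
  rewrite -[det_form f t (set_row v i w)]mul1r.
  apply: (@determinant_multilinear _ _ _ _ _ i).
  - by apply/rowP => j; rewrite !mxE !eqxx mul1r ?mxE.
  - by apply/matrixP => k j; rewrite !mxE eq_sym (negPf (neq_lift _ _)).
  - by apply/matrixP => k j; rewrite !mxE eq_sym (negPf (neq_lift _ _)).
apply: (determinant_alternate ij) => k; rewrite !mxE.
by have /rowP/(_ (f k)) := rij; rewrite !mxE.
Qed.

Definition basis_rows p (g : 'I_p -> 'I_m) : 'M[R]_(p, m) :=
  \matrix_i delta_mx 0 (g i).

(** On coordinate fields [ext_d] is a signed sum of derivatives in lattice directions, hence has
    null mean, and a constant of null mean is 0. *)
Lemma exact_const_basis p (eta : form R m p) t (g : 'I_p -> 'I_m) :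
  (forall s, eta s = eta t) -> exact_form eta -> eta t (basis_rows g) = 0.
Proof.
case: p eta g => [|p] eta g ce /=; first by move=> ->.
case=> beta [_ _ sb] db; apply: (@null_mean_cst R 'rV[R]_m).
rewrite (_ : (fun=> _) = (fun x : 'rV[R]_m => \sum_(i < p.+1)
    (-1) ^+ i * (tderive (delta_mx 0 (g i)) (fun s => beta s (row' i (basis_rows g)))
      \o \pi_(torus R m)) x)); last first.
  apply/funext => x; rewrite -(ce (\pi_(torus R m) x)) -db.
  by apply: eq_bigr => i _; rewrite rowK.
apply: null_mean_sum => i; apply: null_meanZ; apply: null_mean_tderive => //.
exact: delta_mx_lattice.
Qed.

Definition draw p := {A : {set 'I_m} | #|A| == p}.

Definition draw_fun p (A : draw p) (i : 'I_p) : 'I_m :=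
  enum_val (cast_ord (esym (eqP (valP A))) i).

Lemma card_draw p : #|{: draw p}| = 'C(m, p).
Proof.
rewrite card_sig -[m in RHS]card_ord -card_draws; apply: eq_card => A.
by rewrite !inE.
Qed.

Lemma draw_fun_inj p (A : draw p) : injective (draw_fun A).
Proof. by move=> i j /enum_val_inj/cast_ord_inj. Qed.

Lemma draw_funP p (A : draw p) a : a \in val A -> exists i, a = draw_fun A i.
Proof.
move=> aA; exists (cast_ord (eqP (valP A)) (enum_rank_in aA a)).
by rewrite /draw_fun cast_ordK enum_rankK_in.
Qed.

Lemma det_form_basis p (A B : draw p) t :
  det_form (draw_fun A) t (basis_rows (draw_fun B)) = (A == B)%:R.
Proof.
have E (i j : 'I_p) :
    basis_rows (draw_fun B) i (draw_fun A j) = (draw_fun A j == draw_fun B i)%:R.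
  by rewrite !mxE eqxx.
rewrite /det_form; have [<-|neqAB] := eqVneq A B.
  rewrite (_ : \matrix_(i, j) _ = 1%:M) ?det1 //; apply/matrixP => i j.
  rewrite !mxE eqxx /= (inj_eq (@draw_fun_inj _ A)) eq_sym //.
have [a aA aB] : exists2 a, a \in val A & a \notin val B.
  apply/subsetPn; apply: contra neqAB => sAB; rewrite -val_eqE eqEcard sAB.
  by rewrite (eqP (valP A)) (eqP (valP B)) leqnn.
have [j aj] := draw_funP aA; rewrite (expand_det_col _ j) big1 // => i _.
rewrite mxE E -aj (_ : (a == _) = false) ?mul0r //.
by apply: contraNF aB => /eqP ->; exact: enum_valP.
Qed.

(** Pascal's rule raises M; the induction starts at p = M - 2, where the coefficient is 'C(M, 2). *)
Lemma ltn_bin (M p : nat) : (2 <= p)%N -> (p.+2 <= M)%N -> (M < 'C(M, p))%N.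
Proof.
elim: M p => // M IH p p2; rewrite leq_eqVlt => /predU1P[/eq_add_S pM|pM]; last first.
  case: p p2 pM => // p p2 pM; rewrite binS; have := IH _ p2 pM.
  by have : (0 < 'C(M, p))%N by [rewrite bin_gt0; lia]; lia.
rewrite -pM -bin_sub; last by lia.
by rewrite (_ : p.+2 - p = 2)%N ?bin2; nia.
Qed.

End ConstantForms.

Section ConsRows.
Local Open Scope ring_scope.
Variables (R : realType) (m p : nat) (x : 'rV[R]_m) (v : 'M[R]_(p, m)).
Let w : 'M[R]_(p.+1, m) := col_mx x v.

Lemma row0_col_mx : row ord0 w = x.
Proof.
apply/rowP => j; rewrite mxE /w.
rewrite (_ : ord0 = lshift p (ord0 : 'I_1)); last exact: val_inj.
by rewrite (@col_mxEu _ 1 p).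
Qed.

Lemma row'0_col_mx : row' ord0 w = v.
Proof.
apply/matrixP => i j; rewrite mxE /w.
rewrite (_ : lift ord0 i = rshift 1 i); last exact: val_inj.
by rewrite (@col_mxEd _ 1 p).
Qed.

Lemma row_lift_col_mx i : row (lift ord0 i) w = row i v.
Proof. by rewrite -[in RHS]row'0_col_mx; apply/rowP => j; rewrite !mxE. Qed.

End ConsRows.

(** * Upper bound for Euler-Lagrange cohomology *)

Section HamiltonianFields.
Local Open Scope ring_scope.
Local Open Scope classical_set_scope.
Local Open Scope quotient_scope.
Variables (R : realType) (n : nat).
Notation V := 'rV[R]_(n + n).
Notation vfield := (vfield R (n + n)).
Implicit Type X : vfield.

Definition symp_contract X (v : V) : torus R (n + n) -> R := fun t => sympl (X t) v.

Lemma symp_contract_linear X : linear_family (symp_contract X).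
Proof. by move=> c u v t; exact: symplPr. Qed.

Let pairing_of (v : V) := fun i => sympl (delta_mx 0 i) v.

Lemma symp_contractE X v :
  symp_contract X v \o \pi_(torus R (n + n)) =
  (row_pairing (pairing_of v) : V -> R^o) \o (X \o \pi_(torus R (n + n))).
Proof.
apply/funext => x.
exact: (row_pairingE (f := fun w => sympl w v) (fun c u w => symplPl c u w v)).
Qed.

Lemma symp_contract_smooth X v : tsmooth X -> tsmooth (symp_contract X v).
Proof.
move=> sX; rewrite /tsmooth symp_contractE.
exact: smooth_linear_comp (@row_pairing_continuous _ _ _) sX.
Qed.

Lemma symp_contract_derive X u v t : tsmooth X ->
  tderive u (symp_contract X v) t = sympl (tderive u X t) v.
Proof.
move=> sX; rewrite /tderive symp_contractE.
have /(congr1 (@^~ (repr t))) := derive_linear_comp u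
  (@row_pairing_continuous R _ (pairing_of v)) sX.
move=> -> /=.
exact/esym/(row_pairingE (f := fun w => sympl w v) (fun c u w => symplPl c u w v)).
Qed.

Lemma tderiveZ (h : torus R (n + n) -> R) c u t : tsmooth h ->
  tderive u (fun s => c * h s) t = c * tderive u h t.
Proof.
move=> sh; have := @tderiveP R (n + n) R u c h (cst 0) t sh (@tsmooth_cst _ _ _ 0).
by rewrite tderive_cst !addr0.
Qed.

Lemma tsmoothZ (h : torus R (n + n) -> R) c : tsmooth h -> tsmooth (fun s => c * h s).
Proof.
move=> sh; have := @tsmoothP R (n + n) R c h (cst 0) sh (@tsmooth_cst _ _ _ 0).
by rewrite addr0.
Qed.

(** At t the derivative of X is a linear map L to which [symplD_eq0] applies; its [symplD] is the
    difference of the two sides. *)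
Lemma symp_contract_closed k X u v t : (k.+1 < n)%N -> symp_field k.+1 X ->
  tderive u (symp_contract X v) t = tderive v (symp_contract X u) t.
Proof.
move=> kn [sX]; rewrite (lie_derive_const _ (@std_symp_pow_const R n k.+1)
  (@std_symp_pow_multilinear R n k.+1)) => lX.
have LP c (x y : V) : tderive (c *: x + y) X t = c *: tderive x X t + tderive y X t.
  by rewrite /tderive derive_linear.
have D0 (w : 'M[R]_(k.+1 * 2, n + n)) := congr1 (fun e => e t w) lX.
have := symplD_eq0 LP kn D0 u v; rewrite /symplD !symp_contract_derive //.
by rewrite (symplN u) => /eqP; rewrite subr_eq0 => /eqP.
Qed.

Lemma symp_field_ham k X : (k.+1 < n)%N -> symp_field k.+1 X ->
  (forall j, is_int (fun s : R => symp_contract X (delta_mx 0 j)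
    (\pi_(torus R (n + n)) (s *: delta_mx 0 j))) 0) -> ham_field k.+1 X.
Proof.
move=> kn lX per0; have [sX _] := lX; split=> //.
have sa v := symp_contract_smooth v sX.
have ca u v t := symp_contract_closed u v t kn lX.
have [j|h sh dh] := torus_primitive (sa := sa) (symp_contract_linear X) ca.
  exact: is_int_uniq (line_intP sa _) (per0 j).
pose om := wedge_pow (@std_symp R n) k.
have omc t s : om t = om s by exact: std_symp_pow_const.
(* The minus sign matches [ham_field], which asks for a primitive of the negated contraction. *)
exists (fun t v => - k.+1%:R * om t v * h t).
  split=> [t v i c u w|t v i j ij rij|v].
  - by rewrite /om std_symp_pow_multilinear; ring.
  - rewrite /om (wedge_pow_alternating (@std_sympE R n) t ij rij).
    by rewrite mulr0 mul0r.
  - rewrite (_ : (fun t => _) = fun t => - k.+1%:R * om 0 v * h t).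
      exact: tsmoothZ.
    by apply/funext => t; rewrite (omc t 0).
apply/funext => t; apply/funext => v; rewrite /ext_d.
rewrite [RHS](_ : _ = - wedge_pow (@std_symp R n) k.+1 t
  (col_mx (X t) v : 'M_(k.+1 * 2, n + n))) //.
(* Expanding along the row [X t] matches [ext_d] term by term, since [om] is constant and only h is
   differentiated. *)
rewrite (wedge_pow_expand (@std_sympE R n) (@symplN R n)) -mulNr mulr_sumr.
apply: eq_bigr => i _.
rewrite (_ : (fun s => _) = fun s => - k.+1%:R * om t (row' i v) * h s); last first.
  by apply/funext => s; rewrite (omc s t).
rewrite tderiveZ // dh /symp_contract.
rewrite (row0_col_mx (X t) v) (row_lift_col_mx (X t) v) (row'0_col_mx (X t) v).
by rewrite /om; ring.
Qed.

End HamiltonianFields.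

(** * Linear combinations in subquotients, and dependence of Euler-Lagrange classes *)

Section Subquotients.
Local Open Scope ring_scope.
Local Open Scope quotient_scope.
Variables (F : pzRingType) (V : lmodType F) (P Q : submodClosed V).
Notation pi := (\pi_(subquot P Q)).

Lemma subquot_pi0 : pi 0 = 0.
Proof. by apply: (addIr (pi 0)); rewrite -subquot_piD addr0 add0r. Qed.

Lemma subquot_pi_eq0 (x : sub_lmod P) : pi x = 0 <-> val x \in Q.
Proof.
rewrite -subquot_pi0.
rewrite -[val x \in Q]/(x \in sub_trace Q) -[x in x \in _]subr0.
by rewrite Quotient.idealrBE; split => /eqP.
Qed.

Lemma subquot_pi_sum (I : finType) (c : I -> F) (x : I -> sub_lmod P) :
  pi (\sum_i c i *: x i) = \sum_i c i *: pi (x i).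
Proof.
elim/big_rec2: _ => [|i y z _ <-]; first exact: subquot_pi0.
by rewrite subquot_piD -[c i *: pi _]/(subquot_scale _ _) subquot_scale_pi.
Qed.

End Subquotients.

Section DimensionCount.
Local Open Scope ring_scope.
Local Open Scope classical_set_scope.
Local Open Scope quotient_scope.
Variables (R : realType) (n k : nat).
Hypothesis lt_kn : (k.+1 < n)%N.
Notation EL := (EulerLagrange R n k.+1).
Notation V := 'rV[R]_(n + n).

Let period_of (X : vfield R (n + n)) j := is_int (fun s : R =>
  symp_contract X (delta_mx 0 j) (\pi_(torus R (n + n)) (s *: delta_mx 0 j))).

Lemma is_int_sum (I : finType) (c : I -> R) (g : I -> R -> R) (J : I -> R) :
  (forall i, is_int (g i) (J i)) ->
  is_int (fun s => \sum_i c i * g i s) (\sum_i c i * J i).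
Proof.
move=> gJ; elim: (index_enum I) => [|i r IH].
  rewrite big_nil; exists (fun=> 0) => [s _|]; last by rewrite subrr.
  by rewrite big_nil; exact: is_derive_cst.
rewrite big_cons; under eq_fun do rewrite big_cons.
exact: is_int_linear.
Qed.

(** A combination of representatives with zero periods is Hamiltonian, and only n + n periods have
    to be cancelled. *)
Lemma EulerLagrange_dependent (I : finType) (x : I -> EL) : (n + n < #|I|)%N ->
  exists2 c : I -> R, exists i, c i != 0 & \sum_i c i *: x i = 0.
Proof.
move=> In; pose X i : vfield R (n + n) := val (repr (x i)).
have lX i : symp_field k.+1 (X i) by have /asboolP := valP (repr (x i)).
have /choice[J XJ] : forall i, exists Ji : 'I_(n + n) -> R,
    forall j, period_of (X i) j (Ji j).
  move=> i; suff /choice[Ji XJi] : forall j, exists r, period_of (X i) j r by exists Ji.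
  move=> j; apply: is_int_continuous; apply: line_continuous => v.
  by apply: symp_contract_smooth; case: (lX i).
(* The period matrix has more rows than columns, so a nonzero row vector u satisfies u P = 0. *)
pose P := \matrix_(i < #|I|, j < n + n) J (enum_val i) j.
have : kermx P != 0.
  rewrite -mxrank_eq0 mxrank_ker -lt0n subn_gt0.
  exact: leq_ltn_trans (rank_leq_col P) In.
case/rowV0Pn => u /sub_kermxP uP u0.
have [i ui] : exists i, u 0 i != 0.
  apply/existsP; apply: contra_neqT u0 => /existsPn u0; apply/rowP => i.
  by rewrite mxE; have /negPn/eqP := u0 i.
pose c i := u 0 (enum_rank i); exists c.
  by exists (enum_val i); rewrite /c enum_valK.
have -> : \sum_i c i *: x i = \sum_i c i *: \pi_EL (repr (x i)).
  by apply: eq_bigr => l _; rewrite reprK.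
rewrite -subquot_pi_sum; apply/subquot_pi_eq0/asboolP.
set Y := \sum_i _; have lY : symp_field k.+1 (val Y) by have /asboolP := valP Y.
apply: symp_field_ham => // j.
have vY t : val Y t = \sum_i c i *: X i t.
  by rewrite /Y raddf_sum fct_sumE; apply: eq_bigr => l _.
have -> : 0 = \sum_i c i * J i j.
  have /matrixP/(_ 0 j) := uP; rewrite !mxE => /esym E; apply: (etrans E).
  rewrite (reindex enum_rank) /=; last first.
    by apply: onW_bij; exists enum_val; [exact: enum_rankK|exact: enum_valK].
  by apply: eq_bigr => l _; rewrite mxE enum_rankK.
have := is_int_sum c (XJ^~ j).
congr (is_int _ _); apply/funext => s; rewrite /symp_contract vY.
elim/big_rec2: _ => [|l y1 y2 _ ->]; last by rewrite symplPl.
by have := symplPl (-1) 0 0 (delta_mx 0 j : V); rewrite scaler0 addr0; lra.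
Qed.

End DimensionCount.

(** * Independence of the coordinate classes, and the comparison *)

Section DeRhamLowerBound.
Local Open Scope ring_scope.
Local Open Scope quotient_scope.
Variables (R : realType) (m p : nat).

Lemma det_form_in_closed (A : draw m p) :
  det_form (R := R) (draw_fun A) \in @closed_forms R m p.
Proof. exact/asboolP/det_form_closed. Qed.

Definition det_class (A : draw m p) : deRham R m p :=
  \pi_(deRham R m p) (SubLmod (det_form_in_closed A)).

(** The combination is a constant exact form; evaluating it on the basis rows of B extracts the
    coefficient of B. *)
Lemma det_class_free (c : draw m p -> R) :
  \sum_A c A *: det_class A = 0 -> forall A, c A = 0.
Proof.
rewrite -subquot_pi_sum => /subquot_pi_eq0/asboolP.
rewrite raddf_sum /= => ex B.
set eta := \sum_i _ in ex.
have etaE t : eta t = fun v => \sum_A c A * det_form (draw_fun A) t v.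
  by apply/funext => v; rewrite /eta !fct_sumE; apply: eq_bigr => A _.
have ceta s : eta s = eta 0 by rewrite !etaE.
have := exact_const_basis (draw_fun B) ceta ex.
rewrite etaE (bigD1 B) //= det_form_basis eqxx mulr1 big1 ?addr0 // => A AB.
by rewrite det_form_basis (negPf AB) mulr0.
Qed.

End DeRhamLowerBound.

Theorem corollary5p1 (R : realType) (n k : nat) (hn : (3 <= n)%N)
    (hk1 : (1 < k)%N) (hkn : (k < n)%N) :
  ~ exists f : {linear EulerLagrange R n k -> deRham R (n + n) (2 * k - 1)},
      bijective f.
Proof.
case: k hk1 hkn => // k hk1 hkn [f [g _ gf]].
pose eta := @det_class R (n + n) (2 * k.+1 - 1).
have [|c [A cA] c0] := EulerLagrange_dependent hkn (fun A => g (eta A)).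
  by rewrite card_draw; apply: ltn_bin; lia.
case/eqP: cA; apply: (@det_class_free R).
(* The relation among the preimages is carried back through f, which is linear, while g is given
   only as an inverse map. *)
have := congr1 f c0; rewrite linear0 linear_sum; apply: etrans.
by apply: eq_bigr => B _; rewrite linearZ /= gf.
Qed.
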